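(* Every almost mixed Moore graph of diameter at least three is isomorphic to one of the three $(1,1,3;-1)$-graphs $H_1,H_2,H_3$, each with vertex set $\{0,1,\dots,9\}$, given as follows. $H_1$: edges $0\sim5,\ 1\sim6,\ 2\sim7,\ 3\sim8,\ 4\sim9$; arcs $0\to1\to2\to3\to4\to0$ and $5\to9\to8\to7\to6\to5$. $H_2$: edges $0\sim5,\ 1\sim6,\ 4\sim9,\ 2\sim3,\ 7\sim8$; arcs $0\to1\to2\to7\to6\to5\to9\to8\to3\to4\to0$. $H_3$: edges $1\sim6,\ 2\sim3,\ 0\sim4,\ 5\sim9,\ 7\sim8$; arcs $0\to1\to2\to7\to6\to5\to0$ and $3\to4\to9\to8\to3$.
   Context: A mixed graph $G$ consists of a finite vertex set $V(G)$, a set $E(G)$ of edges (unordered pairs of distinct vertices; $x\sim y$ means $\{x,y\}\in E(G)$) and a set $A(G)$ of arcs (ordered pairs of distinct vertices; $x\to y$ means $(x,y)\in A(G)$), with at most one edge or arc between any two vertices (so no two vertices are joined by both an edge and an arc, nor by arcs in both directions). The order of $G$ is $|V(G)|$. An isomorphism is a bijection of vertex sets preserving and reflecting both edges and arcs. For a vertex $v$, the undirected degree is the number of $u$ with $u\sim v$ and the directed out-degree is the number of $u$ with $v\to u$. A walk of length $m$ from $u$ to $v$ is a sequence $u=v_0,\dots,v_m=v$ with $v_i\sim v_{i+1}$ or $v_i\to v_{i+1}$ for each $i<m$; a path is a walk with distinct vertices. The distance $d(u,v)$ is the length of a shortest path from $u$ to $v$ ($\infty$ if none), and the diameter of $G$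 is the maximum of $d(u,v)$ over all ordered pairs of vertices. Mixed Moore bound: $M(r,z,k)=A\frac{u_1^{k+1}-1}{u_1-1}+B\frac{u_2^{k+1}-1}{u_2-1}$, where $w=(z+r)^2+2(z-r)+1$, $u_1=\frac{z+r-1-\sqrt w}{2}$, $u_2=\frac{z+r-1+\sqrt w}{2}$, $A=\frac{\sqrt w-(z+r+1)}{2\sqrt w}$, $B=\frac{\sqrt w+(z+r+1)}{2\sqrt w}$. An $(r,z,k;-\delta)$-graph is a mixed graph of diameter $k$ with maximum undirected degree $r$, maximum directed out-degree $z$ and order $M(r,z,k)-\delta$. An almost mixed Moore graph is an $(r,z,k;-1)$-graph with $r,z\ge1$. *)

(* Defs.v *)
From mathcomp Require Import all_boot all_order all_algebra.

Set Implicit Arguments.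
Unset Strict Implicit.
Unset Printing Implicit Defensive.

Import GRing.Theory Num.Theory.

(* A set of unordered pairs of distinct vertices is encoded as a symmetric
   irreflexive relation. *)
Record mixedGraph := MixedGraph {
  vertex :> finType;
  edge : rel vertex;
  arc : rel vertex;
  edge_sym : symmetric edge;
  edge_irr : irreflexive edge;
  arc_irr : irreflexive arc;
  arc_excl : forall x y, arc x y -> ~~ edge x y && ~~ arc y x }.

Arguments edge {_} _ _.
Arguments arc {_} _ _.

Definition isomorphic (G H : mixedGraph) : Prop :=
  exists f : G -> H,
    [/\ bijective f,
        forall x y, edge (f x) (f y) = edge x y
      & forall x y, arc (f x) (f y) = arc x y].

Section Invariants.

Variable G : mixedGraph.

Definition undirected_degree (v : G) : nat := #|[set u | edge v u]|.
Definition out_degree (v : G) : nat := #|[set u | arc v u]|.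

Definition max_undirected_degree : nat := \max_(v : G) undirected_degree v.
Definition max_out_degree : nat := \max_(v : G) out_degree v.

Definition step : rel G := fun x y => edge x y || arc x y.

(* The path is u :: p, so that its length is the size m of p. *)
Definition has_path (u v : G) (m : nat) : bool :=
  [exists p : m.-tuple G,
     [&& path step u p, last u p == v & uniq (u :: p)]].

(* The least m such that has_path u v m, and None for an infinite distance;
   the range of m is no restriction, as a path has at most #|G| vertices. *)
Definition dist (u v : G) : option nat :=
  ohead [seq m <- iota 0 #|G| | has_path u v m].

(* The maximum of the distances over all ordered pairs is finite, equal to k. *)
Definition has_diameter (k : nat) : Prop :=
  (forall u v : G, exists2 m, dist u v = Some m & m <= k) /\
  (exists u v : G, dist u v = Some k).

End Invariants.

Section MooreBound.

Local Open Scope ring_scope.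

Variable R : rcfType.

(* No denominator vanishes when r, z >= 1: then w > 0, u1 != 1 and u2 != 1. *)
Definition moore_bound (r z k : nat) : R :=
  let s : R := z%:R + r%:R in
  let w : R := s ^+ 2 + 2 * (z%:R - r%:R) + 1 in
  let u1 := (s - 1 - Num.sqrt w) / 2 in
  let u2 := (s - 1 + Num.sqrt w) / 2 in
  let A := (Num.sqrt w - (s + 1)) / (2 * Num.sqrt w) in
  let B := (Num.sqrt w + (s + 1)) / (2 * Num.sqrt w) in
  A * ((u1 ^+ k.+1 - 1) / (u1 - 1)) + B * ((u2 ^+ k.+1 - 1) / (u2 - 1)).

(* (r, z, k; -delta)-graphs *)
Definition is_rzk_graph (r z k delta : nat) (G : mixedGraph) : Prop :=
  [/\ has_diameter G k,
      max_undirected_degree G = r,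
      max_out_degree G = z
    & #|G|%:R = moore_bound r z k - delta%:R].

Definition almost_mixed_moore (G : mixedGraph) : Prop :=
  exists r z k : nat, [/\ (1 <= r)%N, (1 <= z)%N & is_rzk_graph r z k 1 G].

End MooreBound.

Section ListGraph.

Variables es ars : seq (nat * nat).

Let ledge (x y : nat) : bool := ((x, y) \in es) || ((y, x) \in es).
Let larc (x y : nat) : bool := (x, y) \in ars.

Definition well_formed : bool :=
  all (fun x => [&& ~~ ledge x x, ~~ larc x x &
         all (fun y => larc x y ==> ~~ ledge x y && ~~ larc y x) (iota 0 10)])
      (iota 0 10).

Hypothesis wf : well_formed.

Let mem10 (x : 'I_10) : (x : nat) \in iota 0 10.
Proof. by rewrite mem_iota ltn_ord. Qed.

Fact list_edge_sym : symmetric (fun x y : 'I_10 => ledge x y).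
Proof. by move=> x y; rewrite /ledge orbC. Qed.

Fact list_edge_irr : irreflexive (fun x y : 'I_10 => ledge x y).
Proof. by move=> x; have /and3P[/negbTE] := allP wf _ (mem10 x). Qed.

Fact list_arc_irr : irreflexive (fun x y : 'I_10 => larc x y).
Proof. by move=> x; have /and3P[_ /negbTE] := allP wf _ (mem10 x). Qed.

Fact list_arc_excl (x y : 'I_10) :
  larc x y -> ~~ ledge x y && ~~ larc y x.
Proof.
by have /and3P[_ _ /allP/(_ _ (mem10 y))/implyP] := allP wf _ (mem10 x).
Qed.

(* Vertices 0, ..., 9; each pair in es is an edge, each pair in ars an arc. *)
Definition list_graph : mixedGraph :=
  MixedGraph list_edge_sym list_edge_irr list_arc_irr list_arc_excl.

End ListGraph.

(* The arcs c_0 -> c_1 -> ... -> c_(n-1) -> c_0. *)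
Definition cycle_arcs (c : seq nat) : seq (nat * nat) := zip c (rot 1 c).

Definition H1_edges := [:: (0, 5); (1, 6); (2, 7); (3, 8); (4, 9)].
Definition H1_arcs :=
  cycle_arcs [:: 0; 1; 2; 3; 4] ++ cycle_arcs [:: 5; 9; 8; 7; 6].

Definition H2_edges := [:: (0, 5); (1, 6); (4, 9); (2, 3); (7, 8)].
Definition H2_arcs := cycle_arcs [:: 0; 1; 2; 7; 6; 5; 9; 8; 3; 4].

Definition H3_edges := [:: (1, 6); (2, 3); (0, 4); (5, 9); (7, 8)].
Definition H3_arcs :=
  cycle_arcs [:: 0; 1; 2; 7; 6; 5] ++ cycle_arcs [:: 3; 4; 9; 8].

Definition H1 : mixedGraph := @list_graph H1_edges H1_arcs isT.
Definition H2 : mixedGraph := @list_graph H2_edges H2_arcs isT.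
Definition H3 : mixedGraph := @list_graph H3_edges H3_arcs isT.

(* Main.v *)
(* A walk that never goes back along the edge just used is determined by its
   vertices, and in an (r,z,k;-1)-graph the walks of length at most k from a
   vertex u number one more than the vertices; so exactly one vertex rep(u) is
   reached twice. Let w ~ u and w -> x. Every out-neighbour v of u reaches x, and
   does so through a predecessor of x in its own branch. As w also precedes x,
   x has more than z in-neighbours unless rep(u) is one of these predecessors.
   Applied to two edges at u, or to x and an out-neighbour of x when k >= 4, this
   forces r = 1 and k = 3. For z > 1 the graph is then totally regular and rep(u)
   is the mate of u, which says that the adjacency matrix A satisfies
   A^3 + A^2 - A = J. The irrational roots of t^2 + t - 1 have equal
   multiplicities as eigenvalues of A, so that the traces of A and A^2 give
   z + 1 = 2. For z = 1 the vertices of in-degree 0 are few, since they lie within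
   two edges of each other, and a count finds u, w, x of the required in-degrees.
   The remaining graphs have order 10 and are enumerated by computation. *)
Require Import Defs.
From mathcomp Require Import all_boot all_order all_algebra.
From mathcomp Require Import zify ring lra.
Import Defs.

Set Implicit Arguments.
Unset Strict Implicit.
Unset Printing Implicit Defensive.

(** * Non-backtracking walks *)

(** Counting fixes the undirected degree and the out-degree of every vertex but says nothing about
    in-degrees. This is the obstacle, since the crowding argument applies only to an x of in-degree
    at most z. For z > 1 a vertex with one in-neighbour is shown to have at least z of them, and a
    vertex with none would cause two collisions at its neighbour; as z is the average, all
    in-degrees are z. For z = 1 the second argument fails, because it needs two arcs leaving one
    vertex. A count replaces it: at most r + r^2 vertices have in-degree 0, the in-degrees above 1
    exceed it by the same amount in total, and the order is larger than r^3. The tool throughout is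
    that a collision is unique as a pair of walks, and not only in its end, so that the first steps
    of the walks can tell two collisions apart. *)

Section Walks.

Variable G : mixedGraph.
Implicit Types (a b c u v w x y : G) (p q s : seq G).

Lemma step_neq b c : step b c -> c != b.
Proof.
by apply: contraL => /eqP ->; rewrite /step edge_irr arc_irr.
Qed.

Lemma edge_not_arc b c : edge b c -> arc b c = false.
Proof. by move=> e; apply/negP => /arc_excl /andP[]; rewrite e. Qed.

Lemma edge_not_arc_rev b c : edge b c -> arc c b = false.
Proof. by rewrite edge_sym; apply: edge_not_arc. Qed.

Lemma arc_not_step b c : arc b c -> step c b = false.
Proof.
move=> bc; have /andP[/negbTE e /negbTE r] := arc_excl bc.
by rewrite /step edge_sym e r.
Qed.

Lemma edge_arc_neq u w v : edge u w -> arc u v -> v != w.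
Proof. by move=> e a; apply: contraL e => /eqP <-; case/arc_excl/andP: a. Qed.

Lemma edge_arc_rev_neq w x y : edge y x -> arc w x -> y != w.
Proof. by move=> e a; apply: contraL e => /eqP ->; case/arc_excl/andP: a. Qed.

(* Since two vertices are joined by at most one edge or arc, a walk that never
   traverses an edge back immediately is one without pattern a, b, a. In
   [nbp a b p] the walk b :: p continues a walk whose last two vertices are
   a, b; at the start of a walk, a = b makes the condition vacuous. *)
Fixpoint nbp a b p : bool :=
  if p is c :: p' then [&& step b c, c != a & nbp b c p'] else true.

Definition nbw u p := nbp u u p.

Lemma nbpW a b p : nbp a b p -> nbw b p.
Proof.
by case: p => //= c p /and3P[bc _ H]; rewrite /nbw /= bc step_neq.
Qed.

Lemma nbw_arc u v p : arc u v -> nbw u (v :: p) = nbw v p.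
Proof.
move=> uv; have suv : step u v by rewrite /step uv orbT.
rewrite /nbw /= suv step_neq //=; case: p => //= c p.
have [vc|//] := boolP (step v c); rewrite (step_neq vc) /=.
suff -> : c != u by [].
by apply: contraL vc => /eqP ->; rewrite arc_not_step.
Qed.

Lemma nbp_rcons a b p x :
  nbp a b (rcons p x) =
  [&& nbp a b p, step (last b p) x & x != last a (belast b p)].
Proof. by elim: p a b => [|c p IH] a b //=; rewrite ?andbT // IH !andbA. Qed.

Lemma nbw_rcons u p x :
  nbw u (rcons p x) =
  [&& nbw u p, step (last u p) x & x != last u (belast u p)].
Proof. exact: nbp_rcons. Qed.

Lemma nbw_rcons2 u p x y :
  nbw u (rcons (rcons p x) y) =
  [&& nbw u (rcons p x), step x y & y != last u p].
Proof. by rewrite nbw_rcons last_rcons belast_rcons. Qed.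

Lemma path_nbw u p : path (@step G) u p -> uniq (u :: p) -> nbw u p.
Proof.
rewrite /nbw; suff H a : path (@step G) u p -> uniq (u :: p) -> a \notin p -> nbp a u p.
  by move=> P U; apply: H => //; case/andP: U.
elim: p u a => [|c p IH] u a //= /andP[uc P] /and3P[nu nc U].
rewrite inE negb_or => /andP[ca _]; rewrite uc eq_sym ca /=.
apply: IH => //=; first by rewrite nc U.
by move: nu; rewrite inE negb_or => /andP[].
Qed.

Fixpoint tree (m : nat) a b : seq (seq G) :=
  [::] :: (if m is m'.+1 then
    [seq c :: p | c <- [seq c <- enum G | step b c && (c != a)],
                  p <- tree m' b c] else [::]).

Lemma mem_tree m a b p : (p \in tree m a b) = (size p <= m) && nbp a b p.
Proof.
elim: m a b p => [|m IH] a b [|c p] //.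
rewrite /tree -/tree inE /=; apply/allpairsPdep/idP.
  move=> [c' [p' []]]; rewrite mem_filter => /andP[/andP[bc ca] _].
  by rewrite IH => /andP[sp np] [-> ->]; rewrite ltnS sp bc ca np.
move=> /andP[sp /and3P[bc ca np]]; exists c, p.
by rewrite mem_filter bc ca mem_enum IH np -ltnS sp.
Qed.

Lemma tree_uniq m a b : uniq (tree m a b).
Proof.
elim: m a b => [|m IH] a b //=; apply/andP; split.
  by apply/allpairsPdep => -[? [? []]].
apply: allpairs_uniq_dep => [|c _|]; first by rewrite filter_uniq ?enum_uniq.
  exact: IH.
by move=> [c p] [c' p'] _ _ /= [-> ->].
Qed.

Lemma size_treeS m a b :
  size (tree m.+1 a b) =
  (\sum_(c | edge b c && (c != a)) size (tree m b c)
   + \sum_(c | arc b c && (c != a)) size (tree m b c)).+1.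
Proof.
rewrite /= size_allpairs_dep sumnE big_map big_filter big_enum_cond /=.
congr _.+1; rewrite (bigID (fun c => edge b c)) /=; congr (_ + _).
  by apply: eq_bigl => c; rewrite /step; case: (edge b c); rewrite ?andbF ?andbT.
apply: eq_bigl => c; rewrite /step.
case: (boolP (arc b c)) => [/arc_excl /andP[/negbTE -> _]|_].
  by rewrite andbT.
by rewrite orbF; case: (edge b c); rewrite ?andbF.
Qed.

End Walks.

(* Upper bounds for the number of non-backtracking walks of length at most m
   in a mixed graph with degrees at most r and z: all walks from a vertex, and
   all continuations of a walk that has just traversed an edge. *)
Fixpoint bounds (r z m : nat) : nat * nat :=
  if m is m'.+1 then
    let (t, s) := bounds r z m' in ((r * s + z * t).+1, (r.-1 * s + z * t).+1)
  else (1, 1).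

Definition tau r z m := (bounds r z m).1.
Definition sigma r z m := (bounds r z m).2.

Lemma tauS r z m : tau r z m.+1 = (r * sigma r z m + z * tau r z m).+1.
Proof. by rewrite /tau /sigma /=; case: bounds. Qed.

Lemma sigmaS r z m : sigma r z m.+1 = (r.-1 * sigma r z m + z * tau r z m).+1.
Proof. by rewrite /tau /sigma /=; case: bounds. Qed.

Lemma tau_gt0 r z m : 0 < tau r z m.
Proof. by case: m => // m; rewrite tauS. Qed.

Lemma sigma_gt0 r z m : 0 < sigma r z m.
Proof. by case: m => // m; rewrite sigmaS. Qed.

Lemma tau_sigma r z m : 0 < r -> tau r z m.+1 = sigma r z m.+1 + sigma r z m.
Proof. by case: r => // r _; rewrite tauS sigmaS /=; lia. Qed.

(** Eliminating [sigma] leaves a recurrence whose characteristic roots are the [u1] and [u2] of the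
    Moore bound. *)
Lemma tauSS r z m : 0 < r ->
  tau r z m.+2 = r.-1 * tau r z m.+1 + z * tau r z m.+1 + z * tau r z m + 2.
Proof.
move=> r0; rewrite tauS; have := tau_sigma z m r0; rewrite (tauS r z m).
have := sigmaS r z m; case: r r0 => //= r _; nia.
Qed.

Lemma leq_tau r z m n : m <= n -> tau r z m <= tau r z n.
Proof.
move=> /subnKC <-; elim: (n - m) => [|d IH]; first by rewrite addn0.
apply: leq_trans IH _; rewrite addnS.
suff H i : tau r z i <= tau r z i.+1 /\ sigma r z i <= sigma r z i.+1 by case: (H (m + d)).
elim: i => [|i [H1 H2]]; first by rewrite tau_gt0 sigma_gt0.
rewrite tauS sigmaS (tauS r z i.+1) (sigmaS r z i.+1) !ltnS.
by rewrite !leq_add // leq_mul.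
Qed.

Section Counting.

Variables (G : mixedGraph) (r z : nat).
Implicit Types (a b c u v w x y : G) (p q s : seq G).

Lemma sum_edge_le (F : G -> nat) (B : nat) b :
  (forall c, edge b c -> F c <= B) ->
  \sum_(c | edge b c) F c <= undirected_degree b * B.
Proof.
move=> H; rewrite /undirected_degree -sum_nat_const.
rewrite (eq_bigl (fun c => c \in [set u | edge b u])); last by move=> c; rewrite inE.
by apply: leq_sum => c; rewrite inE => /H.
Qed.

Lemma sum_arc_le (F : G -> nat) (B : nat) b :
  (forall c, arc b c -> F c <= B) ->
  \sum_(c | arc b c) F c <= out_degree b * B.
Proof.
move=> H; rewrite /out_degree -sum_nat_const.
rewrite (eq_bigl (fun c => c \in [set u | arc b u])); last by move=> c; rewrite inE.
by apply: leq_sum => c; rewrite inE => /H.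
Qed.

Lemma size_tree_root m u :
  size (tree m.+1 u u) =
  (\sum_(c | edge u c) size (tree m u c) + \sum_(c | arc u c) size (tree m u c)).+1.
Proof.
rewrite size_treeS; congr (_ + _).+1; apply: eq_bigl => c.
  have [e|//] := boolP (edge u c).
  by rewrite step_neq // /step e.
have [e|//] := boolP (arc u c).
by rewrite step_neq // /step e orbT.
Qed.

Hypotheses (max_r : forall v : G, undirected_degree v <= r)
  (max_z : forall v : G, out_degree v <= z).

Lemma size_tree_le m a b :
  (size (tree m a b) <= tau r z m) /\
  (edge a b -> size (tree m a b) <= sigma r z m).
Proof.
elim: m a b => [|m IH] a b //.
have E : \sum_(c | edge b c) size (tree m b c) <= r * sigma r z m.
  apply: (leq_trans (sum_edge_le (B := sigma r z m) _)).
    by move=> c bc; case: (IH b c) => _; apply.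
  by rewrite leq_mul2r max_r orbT.
have Z : \sum_(c | arc b c && (c != a)) size (tree m b c) <= z * tau r z m.
  rewrite (eq_bigr (fun c => size (tree m b c))) // big_mkcondr /=.
  apply: (leq_trans (sum_arc_le (B := tau r z m) _)).
    by move=> c bc; case: ifP => // _; case: (IH b c).
  by rewrite leq_mul2r max_z orbT.
rewrite size_treeS tauS sigmaS !ltnS; split; first apply: leq_add => //.
  rewrite big_mkcondr /=; apply: leq_trans E; apply: leq_sum => c _.
  by case: ifP.
move=> ab; apply: leq_add => //.
rewrite (eq_bigl (fun c => c \in [set u | edge b u] :\ a)); last first.
  by move=> c; rewrite !inE andbC.
apply: (@leq_trans (\sum_(c in [set u | edge b u] :\ a) sigma r z m)).
  by apply: leq_sum => c; rewrite !inE => /andP[_ bc]; case: (IH b c) => _; apply.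
rewrite sum_nat_const leq_mul2r; apply/orP; right.
have := cardsD1 a [set u | edge b u]; rewrite inE edge_sym ab.
have := max_r b; rewrite /undirected_degree => H1 H2; lia.
Qed.

Hypotheses (r0 : 0 < r) (z0 : 0 < z).

(** A missing neighbour removes a whole branch, which contains at least two walks as r, z >= 1. The
    walks that remain are fewer than the [tau - 1] vertices of a graph of defect one, so there every
    degree is attained. *)
Lemma size_tree_deficient m u :
  (undirected_degree u < r) || (out_degree u < z) ->
  size (tree m.+2 u u) + 2 <= tau r z m.+2.
Proof.
move=> H; rewrite size_tree_root tauS.
have E : \sum_(c | edge u c) size (tree m.+1 u c)
          <= undirected_degree u * sigma r z m.+1.
  by apply: sum_edge_le => c uc; case: (size_tree_le m.+1 u c) => _; apply.
have Z : \sum_(c | arc u c) size (tree m.+1 u c) <= out_degree u * tau r z m.+1.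
  by apply: sum_arc_le => c uc; case: (size_tree_le m.+1 u c).
have S2 : 2 <= sigma r z m.+1.
  by rewrite sigmaS; have := tau_gt0 r z m; nia.
have T2 : 2 <= tau r z m.+1.
  by rewrite tauS; have := tau_gt0 r z m; nia.
have := max_r u; have := max_z u.
move: (undirected_degree u) (out_degree u) (sigma r z m.+1) (tau r z m.+1) H E Z S2 T2.
move: (\sum_(c | edge u c) _) (\sum_(c | arc u c) _) => a b d e s t H E Z S2 T2 ez dr.
have H1 : d * s <= r * s by rewrite leq_mul2r dr orbT.
have H2 : e * t <= z * t by rewrite leq_mul2r ez orbT.
case/orP: H => H.
  have : d.+1 * s <= r * s by rewrite leq_mul2r H orbT.
  lia.
have : e.+1 * t <= z * t by rewrite leq_mul2r H orbT.
lia.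
Qed.

End Counting.

(** Without a, the map f is still onto, hence injective by the count, so every colliding pair
    contains a; by symmetry it contains b. *)
Lemma collision_unique (T : eqType) (V : finType) (s : seq T) (f : T -> V) :
  uniq s -> (forall x, x \in map f s) -> size s <= #|V|.+1 ->
  forall a b c d, a \in s -> b \in s -> c \in s -> d \in s ->
  a != b -> f a = f b -> c != d -> f c = f d ->
  (c = a /\ d = b) \/ (c = b /\ d = a).
Proof.
move=> Us surj size_s.
have inj a b : a \in s -> b \in s -> a != b -> f a = f b ->
    forall c d, c \in s -> d \in s -> c != d -> f c = f d -> c = a \/ d = a.
  move=> sa sb ab fab c d sc sd cd fcd.
  have [->|ca] := eqVneq c a; first by left.
  have [->|da] := eqVneq d a; first by right.
  have mem_rem e : e \in s -> e != a -> e \in rem a s.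
    by move=> se ea; rewrite mem_rem_uniq // inE ea.
  have U : uniq (map f (rem a s)).
    apply: (@leq_size_uniq _ (enum V)); first exact: enum_uniq.
      move=> x _; have /mapP[e se ->] := surj x.
      have [->|ea] := eqVneq e a; last by rewrite map_f ?mem_rem.
      by rewrite fab map_f // mem_rem // eq_sym.
    rewrite size_map size_rem // -cardE; case: (size s) size_s => // n.
  have P : perm_eq (rem a s) (c :: rem c (rem a s)).
    by rewrite perm_to_rem // mem_rem.
  move: U; rewrite (perm_uniq (perm_map f P)) /= => /andP[/negP[]].
  rewrite fcd map_f // mem_rem_uniq ?rem_uniq // inE eq_sym cd /=.
  exact: mem_rem.
move=> a b c d sa sb sc sd ab fab cd fcd.
have := inj a b sa sb ab fab c d sc sd cd fcd.
have ba : b != a by rewrite eq_sym.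
have := inj b a sb sa ba (esym fab) c d sc sd cd fcd.
move=> [] -> [] E; try by [left|right].
  by move: ab; rewrite E eqxx.
by move: ab; rewrite E eqxx.
Qed.

Lemma card_sum_indicator (T : finType) (P : pred T) : #|[set u | P u]| = \sum_u (P u : nat).
Proof. by rewrite -sum1dep_card big_mkcond /=; apply: eq_bigr => u _; case: (P u). Qed.

Lemma card_bigcup_le (I T : finType) (P : pred I) (F : I -> {set T}) :
  #|\bigcup_(i | P i) F i| <= \sum_(i | P i) #|F i|.
Proof.
elim/big_rec2: _ => [|i m A _ H]; first by rewrite cards0.
by apply: leq_trans (leq_card_setU _ _) _; rewrite leq_add2l.
Qed.

(** * The matrix equation A^3 + A^2 - A = J *)

Section WalkMatrix.
Import GRing.Theory Num.Theory.
Local Open Scope ring_scope.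

(** For a rank factorization P = CR, cancelling C on the left and R on the right in CRCR = CR gives
    RC = 1, and CR and RC have the same trace. *)
Lemma mxtrace_idempotent (F : fieldType) n (P : 'M[F]_n) :
  P *m P = P -> \tr P = (\rank P)%:R.
Proof.
move=> PP; rewrite -[in LHS](mulmx_base P) mxtrace_mulC.
suff -> : row_base P *m col_base P = 1%:M by rewrite mxtrace1.
have C : injective (mulmx (col_base P) : 'M_(\rank P, n) -> _).
  exact: row_full_inj (col_base_full P).
have D : injective (mulmxr (row_base P) : 'M_(\rank P) -> _).
  exact: row_free_inj (row_base_free P).
apply: D; rewrite /mulmxr /= mul1mx; apply: C.
rewrite (mulmxA (col_base P)) (mulmxA (col_base P)) mulmx_base -mulmxA mulmx_base.
exact: PP.
Qed.

Lemma sqr_5sqr (a b : nat) : (a ^ 2 = 5 * b ^ 2 -> b = 0)%N.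
Proof.
move=> E; apply/eqP; rewrite -leqn0 leqNgt; apply/negP => b0.
have a0 : (0 < a)%N by move: E; case: (a) => //; rewrite exp0n //; nia.
have := congr1 (logn 5) E; rewrite lognM // ?expn_gt0 ?b0 // !lognX.
rewrite (logn_prime 5 (isT : prime 5)) /=; lia.
Qed.

(** Eliminating t from the two equations gives b^2 + ab = a^2, that is (2b + a)^2 = 5 a^2. *)
Lemma golden_irrational (R : realFieldType) (t : R) (a b : int) :
  t ^+ 2 + t = 1 -> a%:~R * t = b%:~R -> a = 0.
Proof.
move=> Ht E; have H : b ^+ 2 + a * b = a ^+ 2.
  apply/eqP; rewrite -(eqr_int R) !rmorphD !rmorphXn rmorphM /= -E; apply/eqP.
  by rewrite -[RHS]mulr1 -Ht; ring.
have H5 : (absz (2 * b + a)%R ^ 2 = 5 * absz a ^ 2)%N.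
  apply/eqP; rewrite -!abszX -eqz_nat PoszM !abszE !ger0_norm ?sqr_ge0 //.
  by apply/eqP; move: H; lia.
by apply/eqP; rewrite -absz_eq0 (sqr_5sqr H5).
Qed.

(* The eigenvalues of A other than d are 0 and the two roots of t^2 + t - 1,
   and the matrix P of the proof is the projection to the eigenspace of one of
   these roots. As tr P is rational, the two roots have the same multiplicity,
   which is d since tr A = 0. *)
Lemma walk_matrix_degree (R : rcfType) (n d : nat) (A : 'M[R]_n) :
  let J : 'M[R]_n := const_mx 1 in
  (0 < n)%N -> (0 < d)%N ->
  A *m (A *m A) = J - A *m A + A -> A *m J = d%:R *: J -> J *m A = d%:R *: J ->
  \tr A = 0 -> \tr (A *m A) = n%:R -> d = 2%N.
Proof.
move=> J n0 d0 A3 AJ JA trA trA2.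
set A2 := A *m A in A3 trA2.
have A2A : A2 *m A = J - A2 + A by rewrite -A3 /A2 mulmxA.
have JJ : J *m J = n%:R *: J.
  apply/matrixP => i j; rewrite !mxE (eq_bigr (fun=> 1)); last by move=> k _; rewrite !mxE mulr1.
  by rewrite sumr_const card_ord mulr1.
have A2J : A2 *m J = (d%:R ^+ 2) *: J by rewrite /A2 -mulmxA AJ -scalemxAr AJ scalerA.
have JA2 : J *m A2 = (d%:R ^+ 2) *: J by rewrite /A2 mulmxA JA -scalemxAl JA scalerA.
have A4 : A2 *m A2 = d%:R *: J - J + 2%:R *: A2 - A.
  rewrite {1}/A2 -mulmxA A3 !mulmxDr mulmxN AJ A3 -/A2.
  by apply/matrixP => i j; rewrite !mxE; ring.
have AA : A *m A = A2 by [].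
clearbody A2.
(* The cubic equation on the all-ones vector, which has eigenvalue d. *)
have Hn : n%:R = d%:R ^+ 3 + d%:R ^+ 2 - d%:R :> R.
  have : (A *m A2) *m J = (J - A2 + A) *m J by rewrite A3.
  rewrite -mulmxA A2J -scalemxAr AJ mulmxDl mulmxBl JJ A2J AJ.
  move=> /matrixP/(_ (Ordinal n0) (Ordinal n0)); rewrite !mxE => H.
  by move: H; rewrite !mulr1 => H; lra.
pose t : R := (Num.sqrt 5 - 1) / 2.
have s5 : Num.sqrt 5 ^+ 2 = 5 :> R by rewrite sqr_sqrtr // ler0n.
have Ht : t ^+ 2 + t = 1 by rewrite /t; move: s5; set x := Num.sqrt 5 => s5; field: s5.
have Ht2 : t ^+ 2 = 1 - t by lra.
have t3 : 3 + t != 0.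
  apply/eqP => H; have E : t = - 3 by lra.
  have E2 : t ^+ 2 = 9 by rewrite E; ring.
  have /eqP : 5 = 0 :> R by lra.
  by rewrite pnatr_eq0.
(* Let t' = -1 - t be the other root. M = A(A - t) vanishes on the eigenvalues 0 and t of A and
   equals t'(t' - t) = 3 + t on t'. On the all-ones vector it equals e, a part that is removed by
   subtracting (e / n) J. *)
pose M := A2 - t *: A.
pose e : R := d%:R * (d%:R - t).
have MM : M *m M = (3 + t) *: M + (d%:R - 1 - 2 * t) *: J.
  rewrite /M mulmxBl !mulmxBr -!scalemxAl -!scalemxAr A4 A2A AA A3.
  apply/matrixP => i j; rewrite !mxE.
  set x1 := A i j; set x2 := A2 i j.
  have h1 : t ^+ 2 * x1 = x1 - t * x1 by rewrite Ht2; ring.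
  have h2 : t ^+ 2 * x2 = x2 - t * x2 by rewrite Ht2; ring.
  by nra.
have MJ : M *m J = e *: J.
  by rewrite /M mulmxBl A2J -scalemxAl AJ scalerA -scalerBl; congr (_ *: _); rewrite /e; ring.
have JM : J *m M = e *: J.
  by rewrite /M mulmxBr JA2 -scalemxAr JA scalerA -scalerBl; congr (_ *: _); rewrite /e; ring.
have trM : \tr M = n%:R.
  by rewrite /M raddfB /= mxtraceZ trA trA2 mulr0 subr0.
clearbody M.
have nR0 : n%:R != 0 :> R by rewrite pnatr_eq0 -lt0n.
pose P := (3 + t)^-1 *: (M - (e / n%:R) *: J).
have PP : P *m P = P.
  rewrite /P -scalemxAl -scalemxAr; congr (_ *: _).
  rewrite mulmxBl !mulmxBr -!scalemxAl -!scalemxAr MM MJ JM JJ.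
  have key : d%:R - 1 - 2 * t = e / n%:R * (e - 3 - t).
    apply: (mulIf nR0).
    have -> : e / n%:R * (e - 3 - t) * n%:R = e * (e - 3 - t) by field.
    rewrite Hn /e.
    set D : R := d%:R.
    have h1 : t ^+ 2 * D = D - t * D by rewrite Ht2; ring.
    have h2 : t ^+ 2 * D ^+ 2 = D ^+ 2 - t * D ^+ 2 by rewrite Ht2; ring.
    by nra.
  apply/matrixP => i j; rewrite !mxE; set y := M i j.
  by rewrite !mulr1 key; field; rewrite nR0 t3.
have [m trP] : exists m : nat, \tr P = m%:R.
  by exists (\rank P); apply: mxtrace_idempotent.
(* As t is irrational, this forces m = d and n = d^2 + 3d; together with [Hn] it follows that d^3 =
   4d. *)
have E : (m%:R - d%:R) * t = n%:R - d%:R ^+ 2 - 3 * m%:R.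
  have : (3 + t) * \tr P = n%:R - e.
    rewrite /P mxtraceZ mulrA mulfV // mul1r raddfB /= mxtraceZ trM.
    have -> : \tr J = n%:R.
      rewrite /mxtrace (eq_bigr (fun=> 1)); last by move=> i _; rewrite mxE.
      by rewrite sumr_const card_ord.
    by rewrite mulfVK.
  rewrite trP /e => H; nra.
have mdZ : m%:Z - d%:Z = 0.
  apply: (@golden_irrational R t _ (n%:Z - d%:Z ^+ 2 - 3 * m%:Z)) => //.
  rewrite !(rmorphB, rmorphM, rmorphXn) /= -!pmulrn; rewrite E; ring.
have md : m = d by apply/eqP; rewrite -eqz_nat; apply/eqP; lra.
have : n%:R = d%:R ^+ 2 + 3 * d%:R :> R by move: E; rewrite md subrr mul0r; lra.
rewrite -natrX -natrM -natrD => /eqP; rewrite eqr_nat => /eqP n1.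
have : n%:R + d%:R = d%:R ^+ 3 + d%:R ^+ 2 :> R by lra.
rewrite -!natrX -!natrD => /eqP; rewrite eqr_nat => /eqP n2.
have : (d * (d ^ 2) = d * 4)%N by move: n1 n2; rewrite !expnS expn0; nia.
by move/eqP; rewrite eqn_pmul2l // => /eqP; nia.
Qed.

End WalkMatrix.

(** * Graphs of defect one *)

Section DefectOne.

Variables (G : mixedGraph) (r z k : nat).
Hypotheses (r0 : 0 < r) (z0 : 0 < z) (k3 : 3 <= k).
Hypotheses (deg : forall v : G, undirected_degree v = r)
  (out : forall v : G, out_degree v = z).

Implicit Types (a b c u v w x y : G) (p q s : seq G).

Definition walk u p := nbw u p && (size p <= k).

Hypothesis reach : forall u x, exists2 p, walk u p & last u p = x.
Hypothesis order_G : (#|G|).+1 = tau r z k.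

Definition collision u p q := [&& walk u p, walk u q, p != q & last u p == last u q].

Lemma collision_pair u p1 p2 q1 q2 : collision u p1 p2 -> collision u q1 q2 ->
  (q1 = p1 /\ q2 = p2) \/ (q1 = p2 /\ q2 = p1).
Proof.
move=> /and4P[w1 w2 n1 /eqP e1] /and4P[w3 w4 n2 /eqP e2].
have memW p : walk u p -> p \in tree k u u by rewrite mem_tree andbC.
apply: (@collision_unique _ _ (tree k u u) (last u)); rewrite ?memW //.
- exact: tree_uniq.
- by move=> x; have [p /memW Wp <-] := reach u x; apply: map_f.
have [] := @size_tree_le G r z _ _ k u u; try by move=> v; rewrite ?deg ?out.
by rewrite order_G.
Qed.

Lemma collision_last u p1 p2 q1 q2 : collision u p1 p2 -> collision u q1 q2 ->
  last u q1 = last u p1.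
Proof.
move=> c1 c2; have [[-> //]|[-> _]] := collision_pair c1 c2.
by case/and4P: c1 => _ _ _ /eqP.
Qed.

Definition in_degree v : nat := #|[set u | arc u v]|.

Lemma in_degree_sum : \sum_x in_degree x = #|G| * z.
Proof.
rewrite -sum_nat_const -(eq_bigr _ (fun v _ => out v)).
rewrite (eq_bigr (fun x => \sum_u (arc u x : nat))) => [|x _]; last exact: card_sum_indicator.
by rewrite exchange_big; apply: eq_bigr => u _; rewrite -card_sum_indicator.
Qed.

Definition edge_start u p := if p is c :: _ then edge u c else false.

Lemma arc_head_not_edge_start u x q v :
  arc u v -> head x q = v -> ~~ edge_start u q.
Proof. by case: q => //= c q uv ->; case/arc_excl/andP: uv. Qed.

Lemma coll_edge_start u q1 q2 q3 q4 : collision u q1 q2 -> collision u q3 q4 ->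
  ~~ edge_start u q1 -> ~~ edge_start u q3 -> edge_start u q2 -> q4 = q2.
Proof.
move=> c1 c2 n1 n3 e2; have [[_ ->]|[E _]] := collision_pair c1 c2 => //.
by rewrite E e2 in n3.
Qed.

Lemma exists_mate u : exists w, edge u w.
Proof.
have : 0 < #|[set w | edge u w]| by rewrite -/(undirected_degree u) deg.
by case/card_gt0P=> w; rewrite inE => ?; exists w.
Qed.

Lemma exists_out u : exists v, arc u v.
Proof.
have : 0 < #|[set w | arc u w]| by rewrite -/(out_degree u) out.
by case/card_gt0P=> w; rewrite inE => ?; exists w.
Qed.

(** Through v, the vertex x may be at distance k + 1 from u, so only the walk without its last
    vertex is sure to lie in the tree of u. The default of [head] covers v = x, where q is empty and
    the predecessor is u itself. *)
Lemma pred_walk u v x : arc u v ->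
  exists q, [/\ nbw u (rcons q x), size q <= k & head x q = v].
Proof.
move=> uv; have [p /andP[np sp] lp] := reach v x.
exists (belast v p); rewrite size_belast; split => //.
  by rewrite -[in rcons _ _]lp -lastI nbw_arc.
by case: p lp {np sp}.
Qed.

Lemma pred_walks u x : exists Q : G -> seq G, forall v, arc u v ->
  [/\ nbw u (rcons (Q v) x), size (Q v) <= k & head x (Q v) = v].
Proof.
apply: (@fin_all_exists G (fun=> seq G)
  (fun v q => arc u v -> [/\ nbw u (rcons q x), size q <= k & head x q = v])) => v.
have [uv|nuv] := boolP (arc u v); last by exists [::].
by have [q qP] := pred_walk x uv; exists q.
Qed.

Lemma rcons_step u q x : nbw u (rcons q x) -> step (last u q) x.
Proof. by rewrite nbw_rcons => /and3P[]. Qed.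

Lemma rcons_walk u q x : nbw u (rcons q x) -> size q <= k -> walk u q.
Proof. by rewrite nbw_rcons /walk => /and3P[-> _ _] ->. Qed.

Lemma step_cases b c : step b c -> edge b c \/ arc b c.
Proof. by case/orP; [left|right]. Qed.

Lemma nbw_rcons_arc u p x : nbw u p -> arc (last u p) x -> nbw u (rcons p x).
Proof.
move=> np ax; rewrite nbw_rcons np {1}/step ax orbT /=.
case: (lastP p) np ax => [|p' c] np ax.
  by apply: step_neq; rewrite /step ax orbT.
rewrite last_rcons in ax; rewrite belast_rcons /=.
have pc := rcons_step np.
by apply: contraL pc => /eqP <-; rewrite arc_not_step.
Qed.

(* The z out-neighbours v of u all reach x, through predecessors of x lying in
   different branches of the tree of walks from u; together with last u s these
   are too many predecessors for x, unless one of them is met twice. *)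
Lemma crowded u w s x : edge u w -> head u s = w -> nbw u s ->
    size s + 2 <= k -> arc (last u s) x -> in_degree x <= z ->
  exists q q2 v, [/\ collision u q q2, arc u v, head x q = v &
    [\/ q2 = s,
        arc (last u q) x /\ exists v', [/\ arc u v', v != v' & head x q2 = v'] |
        edge (last u q) x /\ q2 = rcons (rcons s x) (last u q)]].
Proof.
move=> uw hs ns ss sx dx.
have s_edge : edge_start u s.
  by case: s hs {ns ss sx} => /= [E|c s ->] //; rewrite E edge_irr in uw.
have [Q QP] := pred_walks u x.
have Qw v p : arc u v -> edge_start u p -> Q v != p.
  move=> uv; have [_ _ h] := QP _ uv; apply: contraL => /eqP <-.
  exact: (arc_head_not_edge_start uv h).
have ws : walk u s by rewrite /walk ns; lia.
(* If the predecessor y of x is joined to x by an edge, that edge can be used from x to y: the walk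
   s, x, y of length [size s + 2] meets y again. *)
have [/existsP[v /andP[uv e]]|nE] := boolP [exists v, arc u v && edge (last u (Q v)) x].
  have [nq sq hq] := QP _ uv; set y := last u (Q v) in e *.
  exists (Q v), (rcons (rcons s x) y), v; split => //; last by apply: Or33.
  have e2 : edge_start u (rcons (rcons s x) y) by case: (s) s_edge.
  rewrite /collision (rcons_walk nq sq) Qw //= last_rcons eqxx andbT.
  rewrite /walk !size_rcons nbw_rcons2 nbw_rcons_arc //.
  rewrite (edge_arc_rev_neq e sx) andbT /step edge_sym e /=; lia.
have arcQ v : arc u v -> arc (last u (Q v)) x.
  move=> uv; have [nq _ _] := QP _ uv.
  have [e|//] := step_cases (rcons_step nq).
  by case/negP: nE; apply/existsP; exists v; rewrite uv.
have [/existsP[v /andP[uv /eqP e]]|nS] :=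
    boolP [exists v, arc u v && (last u (Q v) == last u s)].
  have [nq sq hq] := QP _ uv.
  exists (Q v), s, v; split => //; last exact: Or31.
  by rewrite /collision (rcons_walk nq sq) ws Qw //= e.
have [/existsP[v /existsP[v' /and4P[uv uv' vv' /eqP e]]]|nI] :=
    boolP [exists v, exists v', [&& arc u v, arc u v', v != v' &
                                  last u (Q v) == last u (Q v')]].
  have [nq sq hq] := QP _ uv; have [nq' sq' hq'] := QP _ uv'.
  exists (Q v), (Q v'), v; split => //; last first.
    by apply: Or32; split; [exact: arcQ | exists v'].
  rewrite /collision (rcons_walk nq sq) (rcons_walk nq' sq') e eqxx andbT /=.
  by apply: contraNneq vv' => E; rewrite -hq -hq' E.
exfalso; have : #|[set last u (Q v) | v in [set v | arc u v]]| = z.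
  rewrite card_in_imset; first by rewrite -/(out_degree u) out.
  move=> v v'; rewrite !inE => uv uv' e; apply/eqP; apply: contraNT nI => vv'.
  by apply/existsP; exists v; apply/existsP; exists v'; rewrite uv uv' vv' e eqxx.
have : #|[set last u (Q v) | v in [set v | arc u v]]| <= #|[set a | arc a x] :\ last u s|.
  apply: subset_leq_card; apply/subsetP => y /imsetP[v]; rewrite inE => uv ->.
  rewrite !inE arcQ // andbT; apply: contraNneq nS => e.
  by apply/existsP; exists v; rewrite uv e eqxx.
have := cardsD1 (last u s) [set a | arc a x]; rewrite inE sx.
move: dx; rewrite /in_degree; lia.
Qed.

(** Take u with u ~ w. Each out-neighbour of u supplies a predecessor of x. If this is joined to x
    by an edge, equals w, or comes from another branch too, there is a collision at u. Since there
    is only one collision, discarding one branch leaves z - 1 new in-neighbours besides w. *)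
Lemma in_degree_ge w x : arc w x -> z <= in_degree x.
Proof.
move=> wx; have [u] := exists_mate w; rewrite edge_sym => uw.
have [Q QP] := pred_walks u x.
have Qw v p : arc u v -> edge_start u p -> Q v != p.
  move=> uv; have [_ _ h] := QP _ uv; apply: contraL => /eqP <-.
  exact: (arc_head_not_edge_start uv h).
have nw : nbw u [:: w] by rewrite /nbw /= step_neq /step uw.
have ww : walk u [:: w] by rewrite /walk nw /=; lia.
have cE v : arc u v -> edge (last u (Q v)) x ->
    collision u (Q v) [:: w; x; last u (Q v)].
  move=> uv e; have [nq sq hq] := QP _ uv; set y := last u (Q v) in e *.
  rewrite /collision (rcons_walk nq sq) Qw //= eqxx andbT.
  rewrite /walk (nbw_rcons2 u [:: w] x y) (@nbw_rcons_arc u [:: w]) //.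
  by rewrite /= (edge_arc_rev_neq e wx) andbT /step edge_sym e.
have cS v : arc u v -> last u (Q v) = w -> collision u (Q v) [:: w].
  move=> uv e; have [nq sq hq] := QP _ uv.
  by rewrite /collision (rcons_walk nq sq) ww Qw //= e eqxx.
have cI v v' : arc u v -> arc u v' -> v != v' -> last u (Q v) = last u (Q v') ->
    collision u (Q v) (Q v').
  move=> uv uv' vv' e; have [nq sq hq] := QP _ uv; have [nq' sq' hq'] := QP _ uv'.
  rewrite /collision (rcons_walk nq sq) (rcons_walk nq' sq') e eqxx andbT /=.
  by apply: contraNneq vv' => E; rewrite -hq -hq' E.
have Qinj v v' : arc u v -> arc u v' -> Q v = Q v' -> v = v'.
  by move=> /QP[_ _ h] /QP[_ _ h'] E; rewrite -h -h' E.
have main v0 : arc u v0 ->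
    (forall v, arc u v -> v != v0 ->
       [/\ ~ edge (last u (Q v)) x, last u (Q v) <> w &
           forall v', arc u v' -> v' != v0 -> v != v' ->
             last u (Q v) <> last u (Q v')]) -> z <= in_degree x.
  move=> uv0 H; pose I := [set v | arc u v] :\ v0.
  have IP v : v \in I -> arc u v /\ v != v0 by rewrite !inE => /andP[].
  have card_I : #|I| = z.-1.
    have := cardsD1 v0 [set v | arc u v]; rewrite inE uv0 -/(out_degree u) out.
    by rewrite -/I => ->.
  have card_im : #|[set last u (Q v) | v in I]| = z.-1.
    rewrite card_in_imset // => v v' /IP[uv vv0] /IP[uv' vv0'] e.
    have [_ _ Hv] := H v uv vv0; apply/eqP/negP => /negP vv'.
    exact: Hv uv' vv0' vv' e.
  have : #|[set last u (Q v) | v in I]| <= #|[set a | arc a x] :\ w|.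
    apply: subset_leq_card; apply/subsetP => y /imsetP[v /IP[uv vv0] ->].
    have [nq sq hq] := QP _ uv; have [Hv1 /eqP Hv2 _] := H v uv vv0.
    by rewrite !inE Hv2; have [|//] := step_cases (rcons_step nq).
  have := cardsD1 w [set a | arc a x]; rewrite inE wx card_im.
  rewrite /in_degree; lia.
(* Every collision involves the walk [Q v0], so the others are harmless. *)
have main2 v0 p0 : arc u v0 -> collision u (Q v0) p0 -> z <= in_degree x.
  move=> uv0 c0; apply: (main v0 uv0) => v uv vv0.
  have Hv p : collision u (Q v) p -> p = Q v0.
    move=> c; have [[E _]|[_ //]] := collision_pair c0 c.
    by move: vv0; rewrite (Qinj v v0 uv uv0 E) eqxx.
  split.
  - by move=> /(cE _ uv)/Hv E; have := Qw v0 [:: w; x; last u (Q v)] uv0 uw; rewrite E eqxx.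
  - by move=> /(cS _ uv)/Hv E; have := Qw v0 [:: w] uv0 uw; rewrite E eqxx.
  - move=> v' uv' vv0' vv' /(cI _ _ uv uv' vv')/Hv /(Qinj _ _ uv' uv0) E.
    by rewrite E eqxx in vv0'.
have [/existsP[v /andP[uv e]]|nE] := boolP [exists v, arc u v && edge (last u (Q v)) x].
  exact: main2 uv (cE _ uv e).
have [/existsP[v /andP[uv /eqP e]]|nS] := boolP [exists v, arc u v && (last u (Q v) == w)].
  exact: main2 uv (cS _ uv e).
have [/existsP[v /existsP[v' /and4P[uv uv' vv' /eqP e]]]|nI] :=
    boolP [exists v, exists v', [&& arc u v, arc u v', v != v' &
                                  last u (Q v) == last u (Q v')]].
  exact: main2 uv (cI _ _ uv uv' vv' e).
have [v0 uv0] := exists_out u; apply: (main v0 uv0) => v uv _; split.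
- by move=> e; case/negP: nE; apply/existsP; exists v; rewrite uv.
- by move=> e; case/negP: nS; apply/existsP; exists v; rewrite uv e eqxx.
- move=> v' uv' _ vv' e; case/negP: nI; apply/existsP; exists v; apply/existsP.
  by exists v'; rewrite uv uv' vv' e eqxx.
Qed.

(** If no arc enters x, every walk to x ends with an edge y ~ x. For w ~ x, each arc out of w leads
    to such a y, which is also reached as w, x, y, or by the empty walk when y = w. Different arcs
    give different collisions at w, and z > 1 provides two arcs. *)
Lemma in_degree_gt0 x : 1 < z -> 0 < in_degree x.
Proof.
move=> z1; rewrite lt0n; apply/negP => /eqP d0.
have noarc y : arc y x = false.
  by apply/negP => yx; have := in_degree_ge yx; rewrite d0; lia.
have [w] := exists_mate x; rewrite edge_sym => wx.
have collide v : arc w v -> exists q q2, [/\ collision w q q2, head x q = v,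
    ~~ edge_start w q & q2 = [::] \/ edge_start w q2].
  move=> wv; have [q [nq sq hq]] := pred_walk x wv.
  have vx := edge_arc_neq wx wv.
  have [e|] := step_cases (rcons_step nq); last by rewrite noarc.
  have nsq := arc_head_not_edge_start wv hq.
  have q0 : q != [::] by apply: contraNneq vx => E; rewrite -hq E.
  have [lw|lw] := eqVneq (last w q) w.
    exists q, [::]; split => //; last by left.
    by rewrite /collision (rcons_walk nq sq) q0 lw /= eqxx.
  exists q, [:: x; last w q]; split => //; last by right.
  rewrite /collision (rcons_walk nq sq) /= eqxx andbT; apply/andP; split.
    apply/andP; split; last by rewrite /=; lia.
    by rewrite /nbw /= step_neq /step ?wx //= edge_sym e lw.
  by apply: contraNneq nsq => ->.
have : 1 < #|[set v | arc w v]| by rewrite -/(out_degree w) out.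
case/card_gt1P=> v1 [v2 []]; rewrite !inE => wv1 wv2 v12.
have [q1 [p1 [c1 h1 n1 e1]]] := collide _ wv1.
have [q2 [p2 [c2 h2 n2 e2]]] := collide _ wv2.
have [[E _]|[E _]] := collision_pair c1 c2.
  by move: v12; rewrite -h1 -h2 E eqxx.
case: e1 => e1; last by move: n2; rewrite E e1.
by move: (edge_arc_neq wx wv2); rewrite -h2 E e1 eqxx.
Qed.

Lemma in_degree_eq x : 1 < z -> in_degree x = z.
Proof.
move=> z1; have ge y : z <= in_degree y.
  have := in_degree_gt0 y z1; case/card_gt0P=> w; rewrite inE; exact: in_degree_ge.
have := in_degree_sum; rewrite -sum_nat_const (bigD1 x) //=.
rewrite [in RHS](bigD1 x) //= => E.
have : \sum_(i | i != x) z <= \sum_(i | i != x) in_degree i by apply: leq_sum.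
have := ge x; lia.
Qed.

(** * Two crowding arguments at one vertex *)

Lemma card_out_subset w y : (forall x, arc w x -> arc y x) ->
  forall x, arc y x -> arc w x.
Proof.
move=> H x; have S : [set x | arc w x] \subset [set x | arc y x].
  by apply/subsetP => t; rewrite !inE; apply: H.
have E : [set x | arc w x] = [set x | arc y x].
  by apply/eqP; rewrite eqEcard S -!/(out_degree _) !out /=.
by move: (in_set (fun x => arc y x) x); rewrite -E inE => <-.
Qed.

Lemma walk1 u w : step u w -> walk u [:: w].
Proof. by move=> e; rewrite /walk /nbw /= e step_neq //=; lia. Qed.

Lemma walk2 u w x : step u w -> arc w x -> walk u [:: w; x].
Proof.
move=> e wx; rewrite /walk (@nbw_rcons_arc u [:: w]) //=; first by lia.
by have /andP[] := walk1 e.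
Qed.

(** Both uses of [crowded] find the same collision. In its first and third cases one of the walks
    starts with an edge and is known explicitly; the last four hypotheses keep these walks distinct
    for s and s'. Only the second case remains for both, so the repeated vertex precedes x and
    x'. *)
Lemma crowded_twice u w w' s s' x x' :
    edge u w -> head u s = w -> nbw u s -> size s + 2 <= k ->
    arc (last u s) x -> in_degree x <= z ->
    edge u w' -> head u s' = w' -> nbw u s' -> size s' + 2 <= k ->
    arc (last u s') x' -> in_degree x' <= z ->
    s <> s' -> (forall y, s <> rcons (rcons s' x') y) ->
    (forall y, rcons (rcons s x) y <> s') ->
    (forall y y', rcons (rcons s x) y <> rcons (rcons s' x') y') ->
  exists q q2, [/\ collision u q q2, ~~ edge_start u q, ~~ edge_start u q2, 1 < z &
    arc (last u q) x /\ arc (last u q) x'].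
Proof.
move=> uw hs ns ss sx dx uw' hs' ns' ss' sx' dx' D1 D2 D3 D4.
have [q [q2 [v [c uv h T]]]] := crowded uw hs ns ss sx dx.
have [p [p2 [v' [c' uv' h' T']]]] := crowded uw' hs' ns' ss' sx' dx'.
have nq := arc_head_not_edge_start uv h.
have np := arc_head_not_edge_start uv' h'.
have es (t : G) (a e : seq G) : edge u t -> head u a = t -> edge_start u (a ++ e).
  by case: a => /= [tu E|d a tu ->] //; rewrite -E edge_irr in tu.
have e0 := es _ s [::] uw hs; have e0' := es _ s' [::] uw' hs'.
have e1 y := es _ s [:: x; y] uw hs; have e1' y := es _ s' [:: x'; y] uw' hs'.
rewrite cats0 in e0; rewrite cats0 in e0'.
have catE (a : seq G) t y : a ++ [:: t; y] = rcons (rcons a t) y by rewrite -!cats1 -catA.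
have C1 : edge_start u q2 -> p2 = q2 by apply: coll_edge_start c c' nq np.
have C2 : edge_start u p2 -> q2 = p2 by apply: coll_edge_start c' c np nq.
have n2 (a : seq G) (t : G) y : arc u t -> head y a = t -> ~~ edge_start u a.
  exact: arc_head_not_edge_start.
case: T => [E|[a1 [t [ut vt ht]]]|[_ E]]; case: T' => [E'|[b1 [t' [ut' vt' ht']]]|[_ E']].
- by case: D1; rewrite -E -E' C1 // E.
- by have := n2 _ _ _ ut' ht'; rewrite C1 ?E // e0.
- by case: (D2 (last u p)); rewrite -E -E' C1 // E.
- by have := n2 _ _ _ ut ht; rewrite C2 ?E' // e0'.
- exists q, q2; split=> //; [exact: n2 ut ht| |by rewrite -{2}(collision_last c c')].
  by rewrite -(out u) /out_degree; apply/card_gt1P; exists v, t; rewrite !inE.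
- by have := n2 _ _ _ ut ht; rewrite C2 ?E' -?catE // e1'.
- by case: (D3 (last u q)); rewrite -E -E' C1 // E -catE.
- by have := n2 _ _ _ ut' ht'; rewrite C1 ?E -?catE // e1.
- by case: (D4 (last u q) (last u p)); rewrite -E -E' C1 // E -catE.
Qed.

Lemma crowded_two_edges u w w' x x' :
    edge u w -> edge u w' -> w != w' -> arc w x -> arc w' x' ->
    in_degree x <= z -> in_degree x' <= z ->
  exists q q2, [/\ collision u q q2, ~~ edge_start u q, ~~ edge_start u q2, 1 < z &
    arc (last u q) x /\ arc (last u q) x'].
Proof.
move=> uw uw' ww' wx wx' dx dx'.
have n1 t : edge u t -> nbw u [:: t].
  by move=> e; have /andP[] : walk u [:: t] by apply: walk1; rewrite /step e.
apply: (@crowded_twice u w w' [:: w] [:: w']) => //; try exact: n1; try by (rewrite /=; lia).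
all: have heads (a b : seq G) : w :: a <> w' :: b by case=> E; rewrite E eqxx in ww'.
all: by [apply: heads | move=> ?; apply: heads | move=> ? ?; apply: heads].
Qed.

(** The walks to be kept apart have lengths 1 and 3 for the first level, 2 and 4 for the second;
    length 4 requires 3 < k. *)
Lemma crowded_two_levels u w x x' :
    3 < k -> edge u w -> arc w x -> arc x x' ->
    in_degree x <= z -> in_degree x' <= z ->
  exists q q2, [/\ collision u q q2, ~~ edge_start u q, ~~ edge_start u q2, 1 < z &
    arc (last u q) x /\ arc (last u q) x'].
Proof.
move=> k4 uw wx xx' dx dx'.
have suw : step u w by rewrite /step uw.
have /andP[n1 _] := walk1 suw; have /andP[n2 _] := walk2 suw wx.
by apply: (@crowded_twice u w w [:: w] [:: w; x]) => //=; lia.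
Qed.

Lemma no_two_light_edges u w w' x x' : z = 1 ->
    edge u w -> edge u w' -> w != w' -> arc w x -> arc w' x' ->
  in_degree x <= 1 -> in_degree x' <= 1 -> False.
Proof.
move=> z1 uw uw' ww' wx wx'; rewrite -z1 => dx dx'.
have [q [q2 [_ _ _]]] := crowded_two_edges uw uw' ww' wx wx' dx dx'.
by rewrite z1.
Qed.

Lemma light_path_diameter_eq3 u w x x' : z = 1 -> edge u w -> arc w x -> arc x x' ->
  in_degree x <= 1 -> in_degree x' <= 1 -> k = 3.
Proof.
move=> z1 uw wx wx'; rewrite -z1 => dx dx'.
have [k4|] := ltnP 3 k; last by lia.
have [q [q2 [_ _ _]]] := crowded_two_levels k4 uw wx wx' dx dx'.
by rewrite z1.
Qed.

(** With x1 fixed and x running over the out-neighbours of w, the repeated vertex y acquires all of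
    them, hence has exactly these. As y -> x1, also w -> x1, and x1 is reached through both w and w'
    by walks that start with an edge, unlike those of the collision found. *)
Lemma edge_degree_eq1 u : 1 < z -> r = 1.
Proof.
move=> z1; have [r1|] := ltnP 1 r; last by move: r0; lia.
have dz x : in_degree x <= z by rewrite in_degree_eq.
have : 1 < #|[set v | edge u v]| by rewrite -/(undirected_degree u) deg.
case/card_gt1P=> w [w' []]; rewrite !inE => uw uw' ww'.
have [x0 wx0] := exists_out w; have [x1 wx1] := exists_out w'.
have [q [q2 [c nq nq2 _ [_ yx1]]]] :=
  crowded_two_edges uw uw' ww' wx0 wx1 (dz x0) (dz x1).
have yw x : arc w x -> arc (last u q) x.
  move=> wx; have [p [p2 [c' _ _ _ [yx _]]]] :=
    crowded_two_edges uw uw' ww' wx wx1 (dz x) (dz x1).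
  by rewrite -(collision_last c c').
have wx1' := card_out_subset yw yx1.
have suw : step u w by rewrite /step uw.
have suw' : step u w' by rewrite /step uw'.
have c2 : collision u [:: w; x1] [:: w'; x1].
  rewrite /collision !walk2 //= eqxx andbT.
  by apply: contraNneq ww' => -[->].
by have [[E _]|[E _]] := collision_pair c c2; move: nq nq2; rewrite -E /= uw.
Qed.

(** As for two edges, y and w have the same out-neighbours, so w -> x'. Then x' is reached by w, x'
    and by w, x, x', again a collision of walks that start with an edge. *)
Lemma diameter_eq3 u : 1 < z -> k = 3.
Proof.
move=> z1; have [k4|] := ltnP 3 k; last by lia.
have dz x : in_degree x <= z by rewrite in_degree_eq.
have [w uw] := exists_mate u; have [x wx] := exists_out w.
have [x' xx'] := exists_out x.
have [q [q2 [c nq nq2 _ [_ yx']]]] := crowded_two_levels k4 uw wx xx' (dz x) (dz x').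
have yw t : arc w t -> arc (last u q) t.
  move=> wt; have [t' tt'] := exists_out t.
  have [p [p2 [c' _ _ _ [yt _]]]] := crowded_two_levels k4 uw wt tt' (dz t) (dz t').
  by rewrite -(collision_last c c').
have wx' := card_out_subset yw yx'.
have suw : step u w by rewrite /step uw.
have c2 : collision u [:: w; x'] [:: w; x; x'].
  have w3 : walk u [:: w; x; x'].
    rewrite /walk (@nbw_rcons_arc u [:: w; x]) //=; try lia.
    by have /andP[] := walk2 suw wx.
  rewrite /collision walk2 ?w3 //= eqxx andbT.
  by apply/eqP; case.
by have [[E _]|[E _]] := collision_pair c c2; move: nq nq2; rewrite -E /= uw.
Qed.

(** * The repeated vertex for r = 1 and z > 1 *)

Lemma mate_unique u w w' : r = 1 -> edge u w -> edge u w' -> w = w'.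
Proof.
move=> r1 uw uw'; have : #|[set v | edge u v]| <= 1.
  by rewrite -/(undirected_degree u) deg r1.
by move/card_le1_eqP; apply; rewrite inE.
Qed.

(* With r = 1 and z > 1, the only vertex reached twice from u is its mate: two
   different x on which [crowded] ends in its third case are impossible, and
   the second case gives a vertex y with the out-neighbours of w, and then a
   closed walk from y. *)
Lemma mate_repeated u w : r = 1 -> 1 < z -> edge u w ->
  exists q, collision u q [:: w].
Proof.
move=> r1 z1 uw; have k_eq := diameter_eq3 u z1.
have dz x : in_degree x <= z by rewrite in_degree_eq.
have suw : step u w by rewrite /step uw.
have /andP[n1 _] := walk1 suw.
have cr u' w' x : edge u' w' -> arc w' x ->
  exists q q2, [/\ collision u' q q2, ~~ edge_start u' q &
    q2 = [:: w'] \/ (arc (last u' q) x /\ ~~ edge_start u' q2)].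
  move=> uw' wx; have suw' : step u' w' by rewrite /step uw'.
  have /andP[n1' _] := walk1 suw'.
  have ex x1 : arc w' x1 -> exists q q2, [/\ collision u' q q2, ~~ edge_start u' q &
    [\/ q2 = [:: w'], (arc (last u' q) x1 /\ ~~ edge_start u' q2) |
        q2 = [:: w'; x1; last u' q]]].
    move=> wx1; have [|q [q2 [v [c uv h T]]]] :=
      @crowded u' w' [:: w'] x1 uw' erefl n1' _ wx1 (dz x1); first by rewrite /=; lia.
    have nq := arc_head_not_edge_start uv h.
    exists q, q2; split => //; case: T => [->|[a [v' [uv' _ h']]]|[_ ->]].
    - exact: Or31.
    - by apply: Or32; split; last exact: arc_head_not_edge_start uv' h'.
    - exact: Or33.
  have [q [q2 [c nq T]]] := ex x wx.
  case: T => T; [by exists q, q2; split; [| |left]|by exists q, q2; split; [| |right]|].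
  have : 1 < #|[set v | arc w' v]| by rewrite -/(out_degree w') out.
  case/card_gt1P=> t1 [t2 []]; rewrite !inE => wt1 wt2 t12.
  have [t wt tx] : exists2 t, arc w' t & t != x.
    have [E|] := eqVneq t1 x; last by exists t1.
    by exists t2 => //; rewrite -E eq_sym.
  have [p [p2 [c' np T']]] := ex t wt.
  have E : p2 = q2 by apply: (coll_edge_start c c') => //; rewrite T.
  case: T' => [E'|[_]|E']; first by rewrite E T in E'.
    by rewrite E T /= uw'.
  by move: E'; rewrite E T => -[E1 _]; rewrite E1 eqxx in tx.
have [x wx] := exists_out w.
have [q [q2 [c nq T]]] := cr u w x uw wx.
case: T => [T|[yx nq2]]; first by exists q; rewrite -T.
exfalso; set y := last u q in yx.
have yw t : arc w t -> arc y t.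
  move=> wt; have [p [p2 [c' np [T|[yt _]]]]] := cr u w t uw wt.
    have E : p2 = [:: w] := T.
    have c'' : collision u p [:: w] by rewrite -E.
    by have := coll_edge_start c'' c np nq uw; move: nq2 => /[swap] ->; rewrite /= uw.
  by rewrite /y -(collision_last c c').
have lq2 : last u q2 = y by case/and4P: c => _ _ _ /eqP.
have yNw : y != w.
  apply/eqP => E; have c2 : collision u q [:: w].
    case/and4P: c => wq _ _ _; rewrite /collision wq walk1 //= -/y E eqxx andbT.
    by apply: contraNneq nq => ->.
  by have := coll_edge_start c2 c nq nq uw; move: nq2 => /[swap] ->; rewrite /= uw.
(* Both walks to y have length 3, for otherwise x is reached again. *)
have sz3 p : ~~ edge_start u p -> walk u p -> last u p = y -> size p = 3.
  move=> np /andP[nbp sp] lp; move: sp; rewrite leq_eqVlt k_eq => /orP[/eqP //|sp].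
  have c2 : collision u (rcons p x) [:: w; x].
    rewrite /collision walk2 //= last_rcons eqxx andbT /walk size_rcons k_eq sp andbT.
    rewrite nbw_rcons_arc ?lp //=.
    by apply: contraNneq np; case: (p) => [|d p'] //= [-> _].
  have ne : ~~ edge_start u (rcons p x).
    case: (p) np lp => [_ /= E|//].
    apply/negP => /=; move: yx; rewrite -E => ux.
    by move/edge_not_arc; rewrite ux.
  by have := coll_edge_start c2 c ne nq uw; move: nq2 => /[swap] ->; rewrite /= uw.
have [s3 sq2] : size q = 3 /\ size q2 = 3.
  by case/and4P: c => wq wq2 _ _; rewrite !sz3.
(* A closed walk makes y its own repeated vertex. By [cr] at y, either y is its own mate w', or y ->
   x' for some w' -> x'; then x' is reached directly and through w', so x' = y. *)
have closed t p : arc y t -> walk y (t :: p) -> last t p = y -> False.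
  move=> yt wp lp; have c2 : collision y [::] (t :: p).
    by rewrite /collision wp /walk /= eq_sym lp eqxx.
  have [w' yw'] := exists_mate y; have [x' wx'] := exists_out w'.
  have [p1 [p2 [c3 np [T|[yx' np2]]]]] := cr y w' x' yw' wx'.
    have := collision_last c2 c3; case/and4P: c3 => _ _ _ /eqP ->; rewrite T /= => E.
    by rewrite E edge_irr in yw'.
  have := collision_last c2 c3 => /= E; rewrite E in yx'.
  have c4 : collision y [:: w'; x'] [:: x'].
    have s1 : step y w' by rewrite /step yw'.
    have s2 : step y x' by rewrite /step yx' orbT.
    by rewrite /collision walk2 ?walk1 //= eqxx andbT; apply/eqP; case.
  have := collision_last c2 c4 => /= E'; move: yx'; rewrite E'.
  by rewrite arc_irr.
(* If a walk from w to y starts with an arc w -> t, then y -> t closes it up at y. If it starts with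
   the edge to u, its remainder is a walk from u to y of length at most 2, against [sz3]. *)
have [p wp lp] := reach w y; case: p wp lp => [_ /= E|t p wp /= lp].
  by rewrite E eqxx in yNw.
have /andP[np sp] := wp.
have [e|a] : edge w t \/ arc w t by apply: step_cases; case/and3P: np.
  have tu : t = u by apply: (mate_unique r1 e); rewrite edge_sym.
  rewrite tu in np sp lp; case/and3P: np => _ _ np.
  have ne : ~~ edge_start u p.
    case: (p) np => [//|d p' /and3P[_ dw _] /=].
    by apply: contraNN dw => ud; apply/eqP; exact: mate_unique r1 ud uw.
  have wp' : walk u p by rewrite /walk (nbpW np) ltnW.
  by move: sp; rewrite /= (sz3 p ne wp' lp) k_eq.
apply: (closed t p (yw _ a)) => //; rewrite /walk sp andbT nbw_arc ?yw //.
by rewrite -(nbw_arc _ a).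
Qed.

(** * Counting walks by their ends *)

Definition ends m a b x := count (fun p => last b p == x) (tree m a b).

Lemma endsS m a b x :
  ends m.+1 a b x = (b == x) + \sum_c (step b c && (c != a)) * ends m b c x.
Proof.
rewrite /ends /= count_flatten sumnE !big_map big_filter big_enum_cond /=.
congr (_ + _); rewrite big_mkcond /=; apply: eq_bigr => c _.
by rewrite count_map; case: ifP => _; rewrite ?mul1n.
Qed.

Lemma sum_indicator (F : G -> nat) a : \sum_x F x * (x == a) = F a.
Proof.
rewrite (bigD1 a) //= eqxx muln1 big1 ?addn0 // => x /negbTE ->.
by rewrite muln0.
Qed.

(** Let E be the matrix of the edges. For r = 1 each vertex has one closed walk of length 2, so the
    walks of length 2 without backtracking are counted by A^2 - 1. In length 3, inclusion and
    exclusion over a return at the first or at the last turn gives A^3 - 2A + E, where E counts u,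
    x, u, x. The sum with 1 + A is A^3 + A^2 - A + E. *)
Lemma ends3 u x : r = 1 ->
  ends 3 u u x + step u x =
  \sum_a step u a * step a x + \sum_a step u a * (\sum_b step a b * step b x) + edge u x.
Proof.
move=> r1.
have back v : \sum_a step v a * step a v = 1.
  rewrite (eq_bigr (fun a => (edge v a : nat))) => [|a _].
    by rewrite -card_sum_indicator -/(undirected_degree v) deg.
  have [e|ne] := boolP (edge v a); first by rewrite /step e edge_sym e.
  rewrite /step (negbTE ne) edge_sym (negbTE ne) /=.
  by have [/arc_excl /andP[_ /negbTE ->]|_] := boolP (arc v a); rewrite ?muln0.
have ends1 a b : ends 1 a b x = (b == x) + (step b x && (x != a)).
  rewrite endsS; congr (_ + _).
  rewrite -(sum_indicator (fun c => step b c && (c != a) : nat) x).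
  by apply: eq_bigr => c _; rewrite /ends /= addn0.
rewrite endsS.
have -> : \sum_c (step u c && (c != u)) * ends 2 u c x =
    step u x + \sum_a \sum_b step u a * (step a b && (b != u)) * (b == x)
    + \sum_a \sum_b step u a * (step a b && (b != u)) * (step b x && (x != a)).
  rewrite -[(step u x : nat)](sum_indicator (fun a => step u a : nat) x) -!big_split /=.
  apply: eq_bigr => a _; rewrite endsS.
  have -> : step u a && (a != u) = step u a.
    by have [/step_neq ->|//] := boolP (step u a).
  rewrite mulnDr -addnA; congr (_ + _); rewrite -big_split big_distrr /=.
  by apply: eq_bigr => b _; rewrite ends1 mulnDr mulnDr !mulnA.
have E2 : (u == x) + \sum_a \sum_b step u a * (step a b && (b != u)) * (b == x)
    = \sum_a step u a * step a x.
  rewrite (eq_bigr (fun a => step u a * step a x * (x != u))); last first.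
    by move=> a _; rewrite sum_indicator; case: (step u a); case: (step a x); case: (x != u).
  rewrite -big_distrl /=; have [->|ux] := eqVneq x u; first by rewrite back.
  by rewrite muln1.
have E3 : \sum_a step u a * (\sum_b step a b * step b x) + edge u x =
    \sum_a \sum_b step u a * (step a b && (b != u)) * (step b x && (x != a))
    + 2 * step u x.
  have P1 : \sum_a \sum_b step u a * step a b * step b x * (b == u) = step u x.
    rewrite -[RHS]mul1n -{1}(back u) big_distrl /=; apply: eq_bigr => a _.
    by rewrite sum_indicator.
  have P2 : \sum_a \sum_b step u a * step a b * step b x * (a == x) = step u x.
    rewrite exchange_big /= -[RHS]muln1 -[X in _ = _ * X](back x) big_distrr /=.
    by apply: eq_bigr => b _; rewrite sum_indicator mulnA.
  have P3 : \sum_a \sum_b step u a * step a b * step b x * (b == u) * (a == x) = edge u x.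
    rewrite exchange_big /= (eq_bigr (fun b => step u x * step x b * step b x * (b == u))).
      rewrite sum_indicator; have [e|ne] := boolP (edge u x).
        by rewrite /step e edge_sym e.
      rewrite /step (negbTE ne) edge_sym (negbTE ne) /=.
      by have [/arc_excl /andP[_ /negbTE ->]|] := boolP (arc u x).
    by move=> b _; rewrite sum_indicator.
  rewrite mul2n -addnn -{1}P1 -P2 -P3 -!big_split /=; apply: eq_bigr => a _.
  rewrite big_distrr -!big_split /=; apply: eq_bigr => b _.
  rewrite (eq_sym x).
  by case: (step u a); case: (step a b); case: (step b x); case: (b == u); case: (a == x).
lia.
Qed.

Lemma ends_mate u x : r = 1 -> 1 < z -> ends 3 u u x = 1 + edge u x.
Proof.
move=> r1 z1; have k_eq := diameter_eq3 u z1.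
have memT p : (p \in tree 3 u u) = walk u p by rewrite mem_tree /walk andbC k_eq.
rewrite /ends -size_filter; have U := filter_uniq (fun p => last u p == x) (tree_uniq 3 u u).
have [w uw] := exists_mate u; have [q0 c0] := mate_repeated r1 z1 uw.
have other p q : walk u p -> walk u q -> last u p = x -> last u q = x -> p != q ->
    x = w /\ ((p = q0 /\ q = [:: w]) \/ (p = [:: w] /\ q = q0)).
  move=> wp wq lp lq pq; have c : collision u p q.
    by rewrite /collision /collision wp wq pq lp lq eqxx.
  split; last exact: collision_pair c0 c.
  have := collision_last c0 c; rewrite lp => ->.
  by case/and4P: c0 => _ _ _ /eqP.
have [exw|nex] := eqVneq x w.
  have -> : edge u x by rewrite exw.
  case/and4P: c0 => wq0 ww q0w /eqP lq0.
  suff P : perm_eq [seq p <- tree 3 u u | last u p == x] [:: q0; [:: w]].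
    by rewrite (perm_size P).
  apply: uniq_perm; [exact: U | by rewrite /= inE q0w | move=> p].
  rewrite mem_filter memT !inE; apply/andP/orP.
    move=> [/eqP lp wp]; have [->|pq0] := eqVneq p q0; first by left.
    have lq0x : last u q0 = x by rewrite lq0 exw.
    have [_ [[E _]|[-> _]]] := other p q0 wp wq0 lp lq0x pq0; last by right.
    by rewrite E eqxx in pq0.
  by case=> /eqP ->; [rewrite lq0 exw /= eqxx | rewrite exw /= eqxx].
have -> : edge u x = false.
  by apply: contra_neqF nex => e; exact: mate_unique r1 e uw.
have [p0 wp0 lp0] := reach u x.
suff P : perm_eq [seq p <- tree 3 u u | last u p == x] [:: p0].
  by rewrite (perm_size P).
apply: uniq_perm; [exact: U | by [] | move=> p].
 rewrite mem_filter memT !inE; apply/andP/eqP.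
  move=> [/eqP lp wp]; apply/eqP/negP => /negP pp0.
  by have [E] := other p p0 wp wp0 lp lp0 pp0; rewrite E eqxx in nex.
by move=> ->; rewrite lp0 eqxx.
Qed.

(** The term [edge u x] of [ends3] cancels against the second walk from u to its mate. *)
Lemma cubic_identity u x : r = 1 -> 1 < z ->
  \sum_a step u a * step a x + \sum_a step u a * (\sum_b step a b * step b x)
  = 1 + step u x.
Proof. by move=> r1 z1; have := ends3 u x r1; rewrite ends_mate //; lia. Qed.

Lemma step_row u : r = 1 -> \sum_x step u x = z.+1.
Proof.
move=> r1; have -> : z.+1 = undirected_degree u + out_degree u by rewrite deg out r1.
rewrite /undirected_degree /out_degree !card_sum_indicator -big_split.
apply: eq_bigr => x _ /=; rewrite /step.
have [e|] := boolP (edge u x); first by rewrite edge_not_arc.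
by case: (arc u x).
Qed.

Lemma step_column x : r = 1 -> 1 < z -> \sum_u step u x = z.+1.
Proof.
move=> r1 z1; have -> : z.+1 = undirected_degree x + in_degree x.
  by rewrite deg in_degree_eq // r1.
rewrite /undirected_degree /in_degree !card_sum_indicator -big_split.
apply: eq_bigr => u _ /=; rewrite /step edge_sym.
have [e|] := boolP (edge x u); first by rewrite edge_not_arc_rev.
by case: (arc u x).
Qed.

Lemma arc_degree_eq1 (R : rcfType) : 0 < #|G| -> z = 1.
Proof.
move=> G0; have [z1|] := ltnP 1 z; last by move: z0; lia.
have [u _] := card_gt0P G0.
have r1 := edge_degree_eq1 u z1.
pose e (i : 'I_#|G|) : G := enum_val i.
have sum_e (F : G -> nat) : \sum_(i < #|G|) F (e i) = \sum_x F x.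
  by rewrite [RHS](reindex e) //; apply: onW_bij; apply: enum_val_bij.
have natr_sum (F : G -> nat) :
    (\sum_(i < #|G|) (F (e i))%:R = (\sum_x F x)%:R :> R)%R.
  by rewrite -sum_e (big_morph (fun n => n%:R%R) (GRing.natrD R) (GRing.mulr0n 1%R)).
pose A : 'M[R]_#|G| := (\matrix_(i, j) (step (e i) (e j))%:R)%R.
have AE i j : (A i j = (step (e i) (e j))%:R)%R by rewrite mxE.
have A2 i j : ((A *m A) i j = (\sum_a step (e i) a * step a (e j))%:R)%R.
  by rewrite mxE -natr_sum; apply: eq_bigr => l _; rewrite !AE GRing.natrM.
have A3 i j : ((A *m (A *m A)) i j =
    (\sum_a step (e i) a * (\sum_b step a b * step b (e j)))%:R)%R.
  by rewrite mxE -natr_sum; apply: eq_bigr => l _; rewrite AE A2 GRing.natrM.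
suff [] : z.+1 = 2 by [].
apply: (@walk_matrix_degree R #|G| z.+1 A) => //.
- apply/matrixP => i j; rewrite A3 !mxE.
  have -> : (\sum_k A i k * A k j = (\sum_a step (e i) a * step a (e j))%:R :> R)%R.
    by rewrite -A2 mxE.
  apply/eqP; rewrite -GRing.subr_eq0; apply/eqP.
  have := congr1 (fun n => n%:R%R : R) (cubic_identity (e i) (e j) r1 z1).
  by rewrite /= !GRing.natrD => H; lra.
- apply/matrixP => i j; rewrite mxE (eq_bigr (fun l => (step (e i) (e l))%:R)%R); last first.
    by move=> l _; rewrite AE mxE GRing.mulr1.
  by rewrite (natr_sum (fun a => step (e i) a : nat)) step_row // !mxE GRing.mulr1.
- apply/matrixP => i j.
  rewrite mxE (eq_bigr (fun l => (step (e l) (e j))%:R)%R); last first.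
    by move=> l _; rewrite AE mxE GRing.mul1r.
  by rewrite (natr_sum (fun a => step a (e j) : nat)) step_column // !mxE GRing.mulr1.
- rewrite /mxtrace big1 // => i _; rewrite AE.
  have [/step_neq|//] := boolP (step (e i) (e i)).
  by rewrite eqxx.
(* The only closed walk of length 2 at a vertex goes to the mate and back. *)
- rewrite /mxtrace (eq_bigr (fun=> 1%R)); first by rewrite GRing.sumr_const card_ord.
  move=> i _; rewrite A2.
  rewrite (eq_bigr (fun a => (edge (e i) a : nat))) => [|a _].
    by rewrite -card_sum_indicator -/(undirected_degree (e i)) deg r1.
  have [ea|ne] := boolP (edge (e i) a); first by rewrite /step ea edge_sym ea.
  rewrite /step (negbTE ne) edge_sym (negbTE ne) /=.
  by have [/arc_excl /andP[_ /negbTE ->]|_] := boolP (arc (e i) a); rewrite ?muln0.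
Qed.

(** * Vertices of in-degree 0 and the case z = 1 *)

Definition early u v x :=
  has (fun p => [&& last u p == x, size p < k & head u p == v]) (tree k u u).

(** In [early] the default u of [head] makes the empty walk start at u, so v != u excludes it. *)
Lemma earlyP u v x : v != u -> reflect
  (exists p, [/\ nbw u (v :: p), size (v :: p) < k & last v p = x]) (early u v x).
Proof.
move=> vu; apply: (iffP hasP) => [[p]|[p [np sp lp]]].
  rewrite mem_tree => /andP[_ np] /and3P[/eqP lp sp].
  case: p np lp sp => [_ _ _ /= uv|c p np lp sp /= /eqP E].
    by rewrite eq_sym uv in vu.
  by subst c; exists p.
exists (v :: p); first by rewrite mem_tree (ltnW sp); exact: np.
by rewrite sp /= lp !eqxx.
Qed.

(* All walks to a vertex x of in-degree 0 end with an edge. If x is not met early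
   on after the arc from u to v, its neighbours are met too often. *)
Lemma source_repeated u v x : in_degree x = 0 -> arc u v -> ~~ early u v x ->
  exists q q2, collision u q q2 /\ edge (last u q) x.
Proof.
move=> dx uv nB.
have vu : v != u by apply: step_neq; rewrite /step uv orbT.
have noarc y : arc y x = false.
  by apply/negP => yx; move/eqP: dx; rewrite cards_eq0 => /eqP/setP/(_ y); rewrite !inE yx.
have noB p : walk u (v :: p) -> last v p = x -> size (v :: p) < k -> False.
  by move=> /andP[np _] lp sp; case/(earlyP _ vu): nB; exists p.
have vx : v != x by apply: contraTneq uv => ->; rewrite noarc.
have predE q : nbw u (rcons q x) -> edge (last u q) x.
  by move/rcons_step/step_cases; rewrite noarc; case.
(* Suppose that some walk of length below k reaches x; by [noB] it does not start with v. The
   predecessor y of x found through v is then met again, on this walk or one step after it. *)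
have [/hasP[p]|nS] := boolP (has (fun p => (last u p == x) && (size p < k)) (tree k u u)).
  rewrite mem_tree => /andP[_ np] /andP[/eqP lp sp].
  have {}np : nbw u p := np.
  have [q [nq sq hq]] := pred_walk x uv.
  have e := predE _ nq; set y := last u q in e.
  have wq := rcons_walk nq sq.
  have [q' def_q] : exists q' : seq G, q = v :: q'.
    case: (q) hq => [/= E|c q' /= ->]; last by exists q'.
    by rewrite E eqxx in vx.
  exists q; case: (lastP p) np lp sp => [|p' t] np lp sp.
    exists [:: y]; split; last exact: e.
    have uy : edge u y by rewrite edge_sym; move: lp => /= ->.
    rewrite /collision wq walk1 /=; last by rewrite /step uy.
    rewrite eqxx andbT def_q; apply/eqP => -[E _].
    by have := edge_arc_neq uy uv; rewrite E eqxx.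
  rewrite last_rcons in lp; subst t; rewrite size_rcons in sp.
  have wp' : walk u p' by apply: (rcons_walk np); move: sp; clear; lia.
  have [ly|ly] := eqVneq (last u p') y.
    exists p'; split; last exact: e.
    rewrite /collision wq wp' ly eqxx andbT /=; apply/eqP => E.
    apply: (@noB (rcons q' x)); last by rewrite /= size_rcons; move: sp; rewrite -E def_q.
      by rewrite /walk -rcons_cons -def_q nq def_q /= size_rcons; move: sp; rewrite -E def_q /=; clear; lia.
    by rewrite last_rcons.
  exists (rcons (rcons p' x) y); split; last exact: e.
  rewrite /collision wq last_rcons eqxx andbT /walk !size_rcons nbw_rcons2 np.
  rewrite {1}/step edge_sym e eq_sym ly /=; apply/andP; split; first by move: sp; clear; lia.
  apply/eqP => E; case: p' np wp' ly sp E => [|c p'] np wp' ly sp.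
    by rewrite def_q => -[E _]; rewrite E eqxx in vx.
  rewrite def_q => -[E _]; subst c.
  apply: (@noB (rcons p' x)); rewrite ?last_rcons //.
    by rewrite /walk -rcons_cons np /= size_rcons; move: sp => /=; clear; lia.
  by rewrite /= size_rcons.
(* Otherwise all r + z branches at u lead to neighbours of x, which number only r. A walk from an
   edge neighbour t of u cannot return to u at once, as it would then reach x from u in fewer than k
   steps. *)
have [Q QP] : exists Q : G -> seq G, forall t, step u t ->
    [/\ nbw u (rcons (Q t) x), size (Q t) <= k & head x (Q t) = t].
  apply: (@fin_all_exists G (fun=> seq G)
    (fun t q => step u t -> [/\ nbw u (rcons q x), size q <= k & head x q = t])) => t.
  have [ut|nut] := boolP (step u t); last by exists [::].
  have [e|a] := step_cases ut; last by have [q qP] := pred_walk x a; exists q.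
  have [p /andP[np sp] lp] := reach t x.
  exists (belast t p) => _; rewrite size_belast; split => //; last first.
    by case: (p) lp.
  rewrite -[in rcons _ _]lp -lastI /nbw /= ut step_neq //=.
  case: p np sp lp => [//|c p] np sp lp; case/and3P: (np) => tc ct npc.
  apply/and3P; split; [exact: tc| |exact: npc]; apply/eqP => E; subst c.
  case/hasP: nS; exists p; first by rewrite mem_tree (ltnW sp); exact: nbpW npc.
  by move: lp sp => /= -> ->; rewrite eqxx.
have QE t : step u t -> edge x (last u (Q t)).
  by move=> /QP[nq _ _]; rewrite edge_sym; apply: predE.
have [/existsP[t /existsP[t' /and4P[ut ut' tt' /eqP e]]]|nI] :=
    boolP [exists t, exists t', [&& step u t, step u t', t != t' &
                                  last u (Q t) == last u (Q t')]].
  have [nq sq hq] := QP _ ut; have [nq' sq' hq'] := QP _ ut'.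
  exists (Q t), (Q t'); split; last exact: predE.
  rewrite /collision (rcons_walk nq sq) (rcons_walk nq' sq') e eqxx andbT /=.
  by apply: contraNneq tt' => E; rewrite -hq -hq' E.
exfalso; have : #|[set last u (Q t) | t in [set t | step u t]]| <= #|[set y | edge x y]|.
  by apply: subset_leq_card; apply/subsetP => y /imsetP[t]; rewrite !inE => /QE H ->.
rewrite card_in_imset => [|t t']; last first.
  rewrite !inE => ut ut' e; apply/eqP; apply: contraNT nI => tt'.
  by apply/existsP; exists t; apply/existsP; exists t'; rewrite ut ut' tt' e eqxx.
rewrite -/(undirected_degree x) deg leqNgt => /negP; apply.
have -> : [set t | step u t] = [set t | edge u t] :|: [set t | arc u t].
  by apply/setP => t; rewrite !inE.
rewrite cardsU -/(undirected_degree u) -/(out_degree u) deg out.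
rewrite (_ : _ :&: _ = set0) ?cards0; first by rewrite subn0 -[X in X < _]addn0 ltn_add2l.
apply/setP => t; rewrite !inE; apply/negP => /andP[e].
by rewrite edge_not_arc.
Qed.

(** By [source_repeated], the repeated vertices of w and of x are both neighbours of x. If x' is not
    met early from w or not from x, one of these vertices is a neighbour of x' as well. Otherwise x'
    is reached from w through v and through x, so it is the repeated vertex of w. *)
Lemma sources_close x w : in_degree x = 0 -> edge w x ->
  forall x', in_degree x' = 0 -> edge x x' \/ exists2 y, edge x y & edge y x'.
Proof.
move=> dx wx x' dx'.
have noarc y : arc y x = false.
  by apply/negP => yx; move/eqP: dx; rewrite cards_eq0 => /eqP/setP/(_ y); rewrite !inE yx.
have [v wv] := exists_out w; have [t xt] := exists_out x.
have vw : v != w by apply: step_neq; rewrite /step wv orbT.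
have tx : t != x by apply: step_neq; rewrite /step xt orbT.
have vx := edge_arc_neq wx wv.
have swx : step w x by rewrite /step wx.
have predE u q : nbw u (rcons q x) -> edge (last u q) x.
  by move/rcons_step/step_cases; rewrite noarc; case.
have ends_pred (u u' : G) p : nbw u (u' :: p) -> last u' p = x -> u' != x ->
    size (u' :: p) < k ->
    exists p', [/\ nbw u (rcons (u' :: p') x), size (u' :: p') < k & u' :: p = rcons (u' :: p') x].
  move=> np lp u'x sp; case: (lastP p) np lp sp => [_ /= E|p' d np].
    by rewrite E eqxx in u'x.
  rewrite last_rcons => E; subst d; rewrite /= size_rcons => sp.
  by exists p'; split => //; exact: ltnW.
(* Meeting x early through v would give two collisions at w: one at x and one at the predecessor of
   x on that walk. *)
have nBw : ~~ early w v x.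
  apply/negP => /(earlyP _ vw)[p [np sp lp]].
  have [p' [np' sp' E]] := ends_pred _ _ _ np lp vx sp.
  have c1 : collision w (v :: p) [:: x].
    rewrite /collision walk1 //= lp eqxx !andbT /walk np ltnW //=.
    by apply/eqP => -[Ev _]; rewrite Ev eqxx in vx.
  have wp' : walk w (v :: p') by apply: (rcons_walk np'); exact: ltnW.
  have e := predE _ _ np'.
  have [y c2] : exists s, collision w (v :: p') s.
    have [ly|ly] := eqVneq (last w (v :: p')) w.
      by exists [::]; rewrite /collision wp' ly /walk /= eqxx.
    exists [:: x; last w (v :: p')]; rewrite /collision wp' /= eqxx andbT.
    apply/andP; split; last by apply/eqP => -[Ev _]; rewrite Ev eqxx in vx.
    rewrite /walk /nbw; move: ly e; set y := last w _ => ly e /=.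
    by rewrite swx step_neq //= ly /step edge_sym e /= ltnW.
  have [[E2 _]|[[E2 _] _]] := collision_pair c1 c2; last by rewrite E2 eqxx in vx.
  by move: (congr1 size E) (congr1 size E2); rewrite /= size_rcons; clear; lia.
have nBx : ~~ early x t x.
  apply/negP => /(earlyP _ tx)[p [np sp lp]].
  have [p' [np' sp' E]] := ends_pred _ _ _ np lp tx sp.
  have c1 : collision x (t :: p) [::].
    by rewrite /collision /walk np ltnW //= lp eqxx.
  have wp' : walk x (t :: p') by apply: (rcons_walk np'); exact: ltnW.
  have e := predE _ _ np'.
  have c2 : collision x (t :: p') [:: last x (t :: p')].
    rewrite /collision wp' walk1 /=; last by rewrite /step edge_sym e.
    rewrite eqxx andbT; apply/eqP => -[Et _]; rewrite /= -Et in e.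
    by move: xt; rewrite edge_not_arc_rev.
  have [[E2 _]|[E2 _]] := collision_pair c1 c2; last by [].
  by move: (congr1 size E) (congr1 size E2); rewrite /= size_rcons; clear; lia.
have [q [q2 [c e]]] := source_repeated dx wv nBw.
have [p [p2 [c' e']]] := source_repeated dx xt nBx.
have [Bw|] := boolP (early w v x'); last first.
  case/(source_repeated dx' wv) => a [b [ca ea]]; right; exists (last w q).
    by rewrite edge_sym.
  by rewrite -(collision_last c ca).
have [Bx|] := boolP (early x t x'); last first.
  case/(source_repeated dx' xt) => a [b [ca ea]]; right; exists (last x p).
    by rewrite edge_sym.
  by rewrite -(collision_last c' ca).
left; case/(earlyP _ vw): Bw => a [na sa la]; case/(earlyP _ tx): Bx => b [nb sb lb].
have ca : collision w (v :: a) (x :: t :: b).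
  rewrite /collision /walk na ltnW //= la lb eqxx andbT /=.
  apply/andP; split; last by apply/eqP => -[Ev _]; rewrite Ev eqxx in vx.
  apply/andP; split; last by move: sb; rewrite /=.
  case/and3P: (nb) => xt' _ nt; apply/and3P; split; [by []|exact: step_neq|].
  apply/and3P; split; [exact: xt'| |exact: nt].
  by apply: contraTneq xt => ->; rewrite edge_not_arc_rev.
by rewrite edge_sym -la -[last v a]/(last w (v :: a)) (collision_last c ca).
Qed.

Lemma card_sources_le : #|[set x | in_degree x == 0]| <= r + r * r.
Proof.
have [->|[x]] := set_0Vmem [set x | in_degree x == 0]; first by rewrite cards0.
rewrite inE => /eqP dx; have [w xw] := exists_mate x.
have wx : edge w x by rewrite edge_sym.
pose N y := [set t | edge y t].
apply: (@leq_trans #|N x :|: \bigcup_(y in N x) N y|).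
  apply: subset_leq_card; apply/subsetP => x'; rewrite !inE => /eqP dx'.
  have [->|[y xy yx']] := sources_close dx wx dx'; first by [].
  by apply/orP; right; apply/bigcupP; exists y; rewrite inE.
apply: leq_trans (leq_card_setU _ _) _; rewrite leq_add //.
  by rewrite -(deg x).
apply: leq_trans (card_bigcup_le _ _) _.
by rewrite (eq_bigr (fun=> r)) ?sum_nat_const -/(undirected_degree x) ?deg // => y _; apply: deg.
Qed.

Lemma card_arc_into (Q : pred G) :
  #|[set a | [exists x, arc a x && Q x]]| <= \sum_(x | Q x) in_degree x.
Proof.
apply: leq_trans (card_bigcup_le _ (fun x => [set a | arc a x])).
apply: subset_leq_card; apply/subsetP => a; rewrite inE => /existsP[x /andP[ax Qx]].
by apply/bigcupP; exists x; rewrite ?inE.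
Qed.

(** The in-degrees average 1, and [.-1] truncates at 0, so the excess over 1 balances the vertices
    of in-degree 0. *)
Lemma in_degree_excess : z = 1 ->
  \sum_x (in_degree x).-1 = #|[set x | in_degree x == 0]|.
Proof.
move=> z1; have := in_degree_sum; rewrite z1 muln1 => E.
have E1 : \sum_(x : G) 1 = \sum_x in_degree x by rewrite E sum1_card.
apply/eqP; rewrite -(eqn_add2r (\sum_(x : G) 1)) {2}E1 card_sum_indicator -!big_split /=.
by apply/eqP/eq_bigr => x _; case: (in_degree x) => [|d] //=; rewrite addn1.
Qed.

Definition crowded_out := [set a | [exists x, arc a x && (1 < in_degree x)]].

(** An in-degree d >= 2 is at most 2(d - 1). *)
Lemma card_crowded_out : z = 1 -> #|crowded_out| <= 2 * #|[set x | in_degree x == 0]|.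
Proof.
move=> z1; apply: leq_trans (card_arc_into _) _.
rewrite -(in_degree_excess z1) big_distrr /= big_mkcond /=.
by apply: leq_sum => x _; case: (in_degree x) => [|[|d]] //=; clear; lia.
Qed.

Lemma edge_degree_eq1_z1 : z = 1 -> r = 1.
Proof.
move=> z1; have [r1|] := ltnP 1 r; last by move: r0; clear; lia.
(* Double counting of edges: by [no_two_light_edges] each vertex has at most one neighbour outside
   [crowded_out]. *)
have H : r * #|~: crowded_out| <= #|G|.
  apply: (@leq_trans (\sum_u \sum_(w | (w \notin crowded_out) && edge u w) 1)).
    rewrite (exchange_big_dep (fun w => w \notin crowded_out)) /=; last by move=> u w _ /andP[].
    rewrite mulnC -sum_nat_const (eq_bigl (fun w => w \notin crowded_out)); last by move=> w; rewrite inE.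
    apply: leq_sum => w Bw; rewrite sum1dep_card -(deg w) /undirected_degree.
    apply: subset_leq_card; apply/subsetP => u; rewrite inE => wu.
    by rewrite inE Bw edge_sym wu.
  rewrite -sum1_card; apply: leq_sum => u _; rewrite sum1dep_card.
  rewrite leqNgt; apply/negP => /card_gt1P[w [w' []]].
  rewrite !inE => /andP[B uw] /andP[B' uw'] ww'.
  have out1 (a : G) : ~~ [exists x, arc a x && (1 < in_degree x)] ->
      exists2 x, arc a x & in_degree x <= 1.
    move=> nB; have [x ax] := exists_out a; exists x => //; rewrite leqNgt.
    by apply: contra nB => dx; apply/existsP; exists x; rewrite ax.
  have [x wx dx] := out1 _ B; have [x' wx' dx'] := out1 _ B'.
  exact: no_two_light_edges z1 uw uw' ww' wx wx' dx dx'.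
have := cardsC crowded_out; have := card_crowded_out z1; have := card_sources_le.
have : tau r 1 3 <= #|G|.+1 by rewrite order_G z1 leq_tau.
(* For r > 1 and n vertices, [H] yields (r - 1) n <= 2 r^2 + 2 r^3, against n + 1 >= [tau r 1 3]. *)
have -> : tau r 1 3 = r * r * r + 2 * (r * r) + 4 * r + 4.
  by case: r r0 => // d _; rewrite /tau /=; nia.
move: H; move: #|crowded_out| #|~: crowded_out| #|G| #|[set x | in_degree x == 0]|.
move: r0; clear; move=> r0 b c n s; nia.
Qed.

Lemma diameter_eq3_z1 : z = 1 -> r = 1 -> k = 3.
Proof.
move=> z1 r1; have [k4|] := ltnP 3 k; last by move: k3; clear; lia.
pose second := [set a | [exists x, arc a x && (x \in crowded_out)]].
have H2 : #|second| <= 3 * #|[set x | in_degree x == 0]|.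
  apply: leq_trans (card_arc_into _) _.
  apply: (@leq_trans (\sum_(x in crowded_out) 1 + \sum_x (in_degree x).-1)).
    rewrite (big_mkcond (fun x => x \in crowded_out)) [X in _ <= X + _]big_mkcond -big_split /=.
    by apply: leq_sum => x _; case: ifP => // _; case: (in_degree x).
  by rewrite sum1_card in_degree_excess //; have := card_crowded_out z1; clear; lia.
(* [tau 1 1 4] is 19. At most 2 vertices have in-degree 0, so [crowded_out] and [second] cover at
   most 4 + 6 vertices. *)
have n18 : 18 <= #|G|.
  by rewrite -ltnS order_G r1 z1; apply: leq_trans (leq_tau 1 1 k4); rewrite /tau.
have [w] : exists w, w \in ~: (crowded_out :|: second).
  apply/set0Pn; rewrite -card_gt0.
  have : #|crowded_out :|: second| + #|~: (crowded_out :|: second)| = #|G| := cardsC _.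
  have := (leq_card_setU crowded_out second).1; have := card_crowded_out z1.
  have := card_sources_le; rewrite r1; move: n18 H2; 
  move: #|_ :|: _| #|~: _| #|second| #|crowded_out| #|[set x | in_degree x == 0]| #|G|.
  clear; lia.
rewrite in_setC in_setU negb_or => /andP[nB nS].
have [u] := exists_mate w; rewrite edge_sym => uw.
have [x wx] := exists_out w; have [x' xx'] := exists_out x.
apply: (light_path_diameter_eq3 z1 uw wx xx'); rewrite leqNgt.
  by apply: contra nB => dx; rewrite inE; apply/existsP; exists x; rewrite wx.
apply: contra nS => dx; rewrite inE; apply/existsP; exists x; rewrite wx inE.
by apply/existsP; exists x'; rewrite xx'.
Qed.

End DefectOne.

(** * The graphs of order 10 *)

(* A graph with r = z = 1 is given by two functions, the mate [f false] and the
   out-neighbour [f true]. Vertices are labelled in the order in which they are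
   discovered; entry 2 i + b of a table is the label of [f b] of the vertex i. *)
Definition lookup (t : seq nat) (i : nat) (b : bool) : option nat :=
  if i.*2 + b < size t then Some (nth 0 t (i.*2 + b)) else None.

Definition eval_word (t : seq nat) (i : nat) (w : seq bool) : option nat :=
  foldl (fun o b => obind (fun j => lookup t j b) o) (Some i) w.

(** The words of length at most 3 without two consecutive [false], which would lead from a vertex to
    its mate and back; their number is [tau 1 1 3], one more than the order. *)
Definition short_words : seq (seq bool) :=
  [:: [::]; [:: false]; [:: true]; [:: false; true]; [:: true; false]; [:: true; true];
      [:: false; true; false]; [:: false; true; true]; [:: true; false; true];
      [:: true; true; false]; [:: true; true; true]].

Definition two_repeats (s : seq nat) : bool := (size (undup s)).+1 < size s.

Definition bad_label (t : seq nat) (i : nat) : bool :=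
  [|| lookup t i false == Some i,
      (if lookup t i false is Some j then
         if lookup t j false is Some i' then i' != i else false else false)
    | two_repeats (pmap (eval_word t i) short_words)].

Definition table_graph := (seq nat * seq nat)%type.

Definition op_table (h : table_graph) (b : bool) : seq nat := if b then h.2 else h.1.

(** Follows the labelling rule of [search] on a known graph, so a complete table of this graph
    should match the list obtained from some starting vertex. *)
Fixpoint discover (h : table_graph) (fuel j : nat) (s : seq nat) : seq nat :=
  if fuel is fuel'.+1 then
    let x := nth 0 (op_table h (odd j)) (nth 0 s j./2) in
    discover h fuel' j.+1 (if x \in s then s else rcons s x)
  else s.

Definition orders (h : table_graph) : seq (seq nat) :=
  [seq discover h 20 0 [:: i] | i <- iota 0 10].

(** All 20 entries are compared, so soundness rests on this test and [discover] merely proposes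
    candidates. *)
Definition matches (h : table_graph) (t s : seq nat) : bool :=
  [&& uniq s, size s == 10, all (fun x => x < 10) s &
      all (fun j => nth 0 s (nth 0 t j) == nth 0 (op_table h (odd j)) (nth 0 s j./2))
          (iota 0 20)].

Definition T1 : table_graph :=
  ([:: 5; 6; 7; 8; 9; 0; 1; 2; 3; 4], [:: 1; 2; 3; 4; 0; 9; 5; 6; 7; 8]).
Definition T2 : table_graph :=
  ([:: 5; 6; 3; 2; 9; 0; 1; 8; 7; 4], [:: 1; 2; 7; 4; 0; 9; 5; 6; 3; 8]).
Definition T3 : table_graph :=
  ([:: 4; 6; 3; 2; 0; 9; 1; 8; 7; 5], [:: 1; 2; 7; 4; 9; 0; 5; 6; 3; 8]).

Definition recognized (t : seq nat) : bool :=
  [|| has (matches T1 t) (orders T1), has (matches T2 t) (orders T2)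
    | has (matches T3 t) (orders T3)].

(* Nested [if]s, as [vm_compute] evaluates both arguments of [&&]. *)
Fixpoint search (fuel : nat) (t : seq nat) (c : nat) : bool :=
  if has (bad_label t) (iota 0 c) then true else
  if size t == 20 then (c == 10) && recognized t else
  if fuel is fuel'.+1 then
    if (size t)./2 < c then
      if all (fun d => search fuel' (rcons t d) c) (iota 0 c) then
        if c < 10 then search fuel' (rcons t c) c.+1 else true
      else false
    else false
  else false.

(** Since [search] answers [false] on a table that closes up on fewer than ten labels, this
    computation also shows that all such tables are pruned. *)
Lemma search_complete : search 20 [::] 1.
Proof. by vm_cast_no_check (erefl true). Qed.

Definition represents (h : table_graph) (es ars : seq (nat * nat)) : bool :=
  all (fun x => [&& nth 0 h.1 x < 10, nth 0 h.2 x < 10 &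
    all (fun y => ((((x, y) \in es) || ((y, x) \in es)) == (y == nth 0 h.1 x)) &&
                  (((x, y) \in ars) == (y == nth 0 h.2 x))) (iota 0 10)]) (iota 0 10).

Lemma size_undup_cat (T : eqType) (s1 s2 : seq T) :
  size (undup (s1 ++ s2)) <= size (undup s1) + size s2.
Proof.
rewrite -size_cat; apply: uniq_leq_size; first exact: undup_uniq.
by move=> x; rewrite mem_undup !mem_cat mem_undup.
Qed.

Section UnitDegrees.

Variables (G : mixedGraph) (f : bool -> G -> G).
Hypotheses (edge_f : forall x y, edge x y = (y == f false x))
  (arc_f : forall x y, arc x y = (y == f true x)).

Definition act (w : seq bool) (u : G) : G := foldl (fun v b => f b v) u w.

Lemma step_f (x y : G) : step x y -> exists b, y = f b x.
Proof. by rewrite /step edge_f arc_f => /orP[]/eqP ->; [exists false|exists true]. Qed.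

Lemma f_false_inv x : f false (f false x) = x.
Proof.
by apply/esym/eqP; rewrite -edge_f edge_sym edge_f.
Qed.

Lemma f_false_neq x : f false x != x.
Proof. by rewrite eq_sym -edge_f edge_irr. Qed.

Lemma path_act u p : path (@step G) u p ->
  exists2 w, size w = size p & last u p = act w u.
Proof.
elim: p u => [|x p IH] u /=; first by exists [::].
move=> /andP[/step_f[b ->] /IH[w sw ->]].
by exists (b :: w); rewrite /= ?sw.
Qed.

Lemma path_arc_act u p : path (@arc G) u p -> last u p = iter (size p) (f true) u.
Proof.
elim: p u => [|x p IH] u //=; rewrite arc_f => /andP[/eqP -> /IH ->].
by rewrite -iterSr.
Qed.

Hypotheses (card_G : #|G| = 10)
  (cover : forall u x, x \in [seq act w u | w <- short_words]).

Variable x0 : G.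

Definition consistent (t : seq nat) (e : seq G) : Prop :=
  forall j, j < size t ->
    nth 0 t j < size e /\ nth x0 e (nth 0 t j) = f (odd j) (nth x0 e j./2).

Lemma odd_pos i (b : bool) : odd (i.*2 + b) = b.
Proof. by rewrite oddD odd_double; case: b. Qed.

Lemma half_pos i (b : bool) : (i.*2 + b)./2 = i.
Proof. by rewrite addnC half_bit_double. Qed.

Lemma lookupE t e i b d : consistent t e -> lookup t i b = Some d ->
  d < size e /\ nth x0 e d = f b (nth x0 e i).
Proof.
rewrite /lookup => C; case: ifP => // /C[]; rewrite odd_pos half_pos => H1 H2 [<-].
by [].
Qed.

Lemma eval_wordE t e i w d : consistent t e -> eval_word t i w = Some d ->
  nth x0 e d = act w (nth x0 e i).
Proof.
move=> C; rewrite /eval_word /act.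
elim: w i => [|b w IH] i /=; first by case=> ->.
case E: (lookup t i b) => [j|]; last first.
  suff -> : foldl (fun o b => obind (fun j => lookup t j b) o) None w = None by [].
  by elim: (w).
by move=> /IH ->; case: (lookupE C E) => _ ->.
Qed.

(** The 11 words reach all 10 vertices, and each word that the table leaves undefined adds at most
    one of them, so the defined words lose at most one. *)
Lemma not_bad_label t e i : consistent t e -> uniq e -> i < size e -> ~~ bad_label t i.
Proof.
move=> C U ie; rewrite /bad_label !negb_or; apply/and3P; split.
- apply/eqP => /(lookupE C)[_ E]; have := f_false_neq (nth x0 e i).
  by rewrite -E eqxx.
- case E: (lookup t i false) => [j|//]; case E': (lookup t j false) => [i'|//].
  have [lt' E2] := lookupE C E'; have [_ E1] := lookupE C E.
  by rewrite negbK -(nth_uniq x0 lt' ie U) E2 E1 f_false_inv.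
pose P w := isSome (eval_word t i w); pose W w := act w (nth x0 e i).
have defs : pmap (eval_word t i) short_words =
    pmap (eval_word t i) [seq w <- short_words | P w].
  elim: short_words => //= w ws IH; case E: (eval_word t i w) => [d|].
    have -> : P w = true by rewrite /P E.
    by rewrite /= E /= IH.
  by have -> : P w = false by rewrite /P E.
have map_ends : [seq nth x0 e d | d <- pmap (eval_word t i) short_words] =
    [seq W w | w <- [seq w <- short_words | P w]].
  rewrite defs; elim: short_words => //= w ws IH; case E: (eval_word t i w) => [d|].
    have -> : P w = true by rewrite /P E.
    by rewrite /= E /= IH (eval_wordE C E).
  by have -> : P w = false by rewrite /P E.
set s := pmap _ _ in map_ends *; rewrite /two_repeats -leqNgt.
have size_s : size s = size [seq w <- short_words | P w].
  by rewrite -(size_map (nth x0 e)) map_ends size_map.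
have H1 : size (undup [seq W w | w <- [seq w <- short_words | P w]]) <= size (undup s).
  rewrite -(size_map (nth x0 e) (undup s)); apply: uniq_leq_size; first exact: undup_uniq.
  by move=> y; rewrite mem_undup -map_ends => /mapP[d ds ->]; rewrite map_f ?mem_undup.
have H2 : 10 <= size (undup [seq W w | w <- short_words]).
  rewrite -card_G cardE; apply: uniq_leq_size; first exact: enum_uniq.
  by move=> y _; rewrite mem_undup; apply: cover.
have H3 : size (undup [seq W w | w <- short_words]) =
    size (undup ([seq W w | w <- [seq w <- short_words | P w]] ++
                 [seq W w | w <- [seq w <- short_words | ~~ P w]])).
  apply: perm_size; apply: perm_undup; rewrite -map_cat.
  move=> y; apply/esym; apply: perm_mem; apply: perm_map.
  exact: permEl (perm_filterC _ _).
have H4 : size [seq w <- short_words | P w] + size [seq w <- short_words | ~~ P w] = 11.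
  by rewrite !size_filter count_predC.
have := size_undup_cat [seq W w | w <- [seq w <- short_words | P w]]
  [seq W w | w <- [seq w <- short_words | ~~ P w]].
rewrite -H3 size_map size_s; move: H1 H2 H4; clear; lia.
Qed.

Lemma consistent_rcons t e i d : consistent t e -> i = (size t)./2 -> i < size e ->
  forall e', d < size e' -> (forall j, j < size e -> nth x0 e' j = nth x0 e j) ->
  size e <= size e' -> nth x0 e' d = f (odd (size t)) (nth x0 e i) ->
  consistent (rcons t d) e'.
Proof.
move=> C Ei ie e' de' ee' se' E j; rewrite size_rcons ltnS leq_eqVlt => /orP[/eqP ->|jt].
  by rewrite nth_rcons ltnn eqxx E -Ei ee'.
have [lj Ej] := C j jt; rewrite nth_rcons jt; split; first exact: leq_trans lj se'.
rewrite ee' // Ej ee' //; apply: leq_ltn_trans ie; rewrite Ei.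
by apply: half_leq; exact: ltnW.
Qed.

(** The graph selects one branch of the search: the next entry is the label of the actual image, or
    a new label. No table on this branch is bad, so it ends in a recognized one. *)
Lemma search_sound fuel t e : search fuel t (size e) -> consistent t e -> uniq e ->
  exists t' e', [/\ consistent t' e', uniq e', size e' = 10, size t' = 20 & recognized t'].
Proof.
elim: fuel t e => [|fuel IH] t e /=.
  case: ifP => [/hasP[i]|_].
    by rewrite mem_iota add0n => ie B _ C U; have := not_bad_label C U ie; rewrite B.
  case: ifP => [/eqP st /andP[/eqP se R] C U|_ E]; last by discriminate E.
  by exists t, e; apply: And5 C U se st R.
case: ifP => [/hasP[i]|_].
  by rewrite mem_iota add0n => ie B _ C U; have := not_bad_label C U ie; rewrite B.
case: ifP => [/eqP st /andP[/eqP se R] C U|_].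
  by exists t, e; apply: And5 C U se st R.
case: ifP => // ie; case: ifP => // /allP H1 H2 C U.
set y := f (odd (size t)) (nth x0 e (size t)./2).
have [ye|ye] := boolP (y \in e).
  apply: (IH (rcons t (index y e)) e) => //.
    by apply: H1; rewrite mem_iota add0n index_mem.
  by apply: (consistent_rcons C erefl ie) => //; rewrite ?index_mem ?nth_index.
have U' : uniq (rcons e y) by rewrite rcons_uniq ye.
have se : size e < 10.
  by have := card_uniqP U'; rewrite size_rcons => <-; rewrite -card_G; apply: max_card.
rewrite se in H2; apply: (IH (rcons t (size e)) (rcons e y)) => //.
  by rewrite size_rcons.
apply: (consistent_rcons C erefl ie); rewrite ?size_rcons //.
  by move=> j je; rewrite nth_rcons je.
by rewrite nth_rcons ltnn eqxx.
Qed.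

Lemma matches_isomorphic t e h s es ars (wf : well_formed es ars) :
  consistent t e -> uniq e -> size e = 10 -> size t = 20 -> matches h t s ->
  represents h es ars -> isomorphic G (list_graph wf).
Proof.
move=> C U se st /and4P[Us /eqP ss /allP s10 /allP M] /allP Rh.
have in_e x : x \in e.
  have := @subset_cardP G (mem e) predT; rewrite (card_uniqP U) se.
  by move=> /(_ (esym card_G) (subset_predT _)) ->.
pose g x := nth 0 s (index x e).
have ie x : index x e < 10 by rewrite -se index_mem.
have g10 x : g x < 10 by apply: s10; rewrite mem_nth ?ss.
have gI x y : g x = g y -> x = y.
  move=> /eqP; rewrite /g nth_uniq ?ss // => /eqP /(congr1 (nth x0 e)).
  by rewrite !nth_index.
have gf b x : g (f b x) = nth 0 (op_table h b) (g x).
  pose j := (index x e).*2 + b.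
  have j20 : j < 20 by rewrite /j; have := ie x; case: (b); lia.
  have := M j; rewrite mem_iota j20 odd_pos half_pos => /(_ isT)/eqP <-.
  have jt : j < size t by rewrite st.
  have [lj] := C j jt.
  rewrite odd_pos half_pos nth_index // => <-.
  by rewrite /g index_uniq.
have gH x y : edge x y = (((g x, g y) \in es) || ((g y, g x) \in es)) /\
              arc x y = ((g x, g y) \in ars).
  have := Rh (g x); rewrite mem_iota g10 => /(_ isT)/and3P[_ _ /allP/(_ (g y))].
  rewrite mem_iota g10 => /(_ isT)/andP[/eqP -> /eqP ->].
  by rewrite -(gf false) -(gf true) edge_f arc_f !(inj_eq gI).
exists (fun x => Ordinal (g10 x)); split.
- apply: inj_card_bij; first by move=> x y [] /gI.
  by rewrite card_ord card_G.
- by move=> x y; case: (gH x y) => ->.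
- by move=> x y; case: (gH x y) => _ ->.
Qed.

Lemma classification : [\/ isomorphic G H1, isomorphic G H2 | isomorphic G H3].
Proof.
have C0 : consistent [::] [:: x0] by [].
have [t [e [C U se st]]] := search_sound (search_complete : search 20 [::] (size [:: x0])) C0 isT.
rewrite /recognized => /or3P[] /hasP[s _ M].
- by apply: Or31; apply: (matches_isomorphic _ C U se st M); vm_compute.
- by apply: Or32; apply: (matches_isomorphic _ C U se st M); vm_compute.
- by apply: Or33; apply: (matches_isomorphic _ C U se st M); vm_compute.
Qed.

End UnitDegrees.

(** * The Moore bound *)

Section MooreBoundTau.
Import Order.TTheory GRing.Theory Num.Theory.
Local Open Scope ring_scope.

Lemma geometric_rec (F : fieldType) (u s z : F) (m : nat) :
  u != 1 -> u ^+ 2 = (s - 1) * u + z ->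
  (u ^+ m.+3 - 1) / (u - 1) = (s - 1) * ((u ^+ m.+2 - 1) / (u - 1))
    + z * ((u ^+ m.+1 - 1) / (u - 1)) + (s + z - 2) / (u - 1).
Proof.
move=> u1 Hu; have u10 : u - 1 != 0 by rewrite subr_eq0.
rewrite !mulrA -!mulrDl; congr (_ / _).
have -> : u ^+ m.+3 = u ^+ m.+1 * u ^+ 2 by rewrite -exprD addn2.
by rewrite Hu (exprS u m.+1); ring.
Qed.

(** Both sides satisfy the recurrence of [tauSS] and have the values 1 and 1 + r + z at 0 and 1. *)
Lemma moore_bound_tau (R : rcfType) (r z k : nat) : (0 < r)%N -> (0 < z)%N ->
  moore_bound R r z k = (tau r z k)%:R.
Proof.
move=> r0 z0; rewrite /moore_bound.
set s : R := z%:R + r%:R; set w : R := _ + 1.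
have zR : 1 <= z%:R :> R by rewrite ler1n.
have rR : 1 <= r%:R :> R by rewrite ler1n.
have w0 : 0 < w by rewrite /w /s; nra.
set q := Num.sqrt w; have q2 : q ^+ 2 = w by rewrite sqr_sqrtr // ltW.
have q0 : 0 < q by rewrite sqrtr_gt0.
set u1 := (s - 1 - q) / 2; set u2 := (s - 1 + q) / 2.
set A := (q - (s + 1)) / (2 * q); set B := (q + (s + 1)) / (2 * q).
have qn : q != 0 by rewrite gt_eqF.
have Eu1 : u1 ^+ 2 = (s - 1) * u1 + z%:R.
  have -> : u1 ^+ 2 = ((s - 1) ^+ 2 - 2 * (s - 1) * q + q ^+ 2) / 4.
    by rewrite /u1; field.
  by rewrite q2 /w /u1 /s; field.
have Eu2 : u2 ^+ 2 = (s - 1) * u2 + z%:R.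
  have -> : u2 ^+ 2 = ((s - 1) ^+ 2 + 2 * (s - 1) * q + q ^+ 2) / 4.
    by rewrite /u2; field.
  by rewrite q2 /w /u2 /s; field.
have N1 (u : R) : u ^+ 2 = (s - 1) * u + z%:R -> u != 1.
  by move=> Eu; apply/eqP => E1; move: Eu; rewrite E1 /s => Eu; nra.
have n1 := N1 _ Eu1; have n2 := N1 _ Eu2.
have d1 : u1 - 1 != 0 by rewrite subr_eq0.
have d2 : u2 - 1 != 0 by rewrite subr_eq0.
have AB : A + B = 1 by rewrite /A /B; field.
have ABu : A * u1 + B * u2 = s by rewrite /A /B /u1 /u2; field.
have prod : (u1 - 1) * (u2 - 1) = 2 - s - z%:R.
  have -> : (u1 - 1) * (u2 - 1) = ((s - 3) ^+ 2 - q ^+ 2) / 4 by rewrite /u1 /u2; field.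
  by rewrite q2 /w /s; field.
(* The inhomogeneous terms of the two geometric sums add up to the constant 2 of [tauSS]. *)
have c : A * ((s + z%:R - 2) / (u1 - 1)) + B * ((s + z%:R - 2) / (u2 - 1)) = 2.
  have -> : s + z%:R - 2 = - ((u1 - 1) * (u2 - 1)) by rewrite prod; ring.
  have -> : A * (- ((u1 - 1) * (u2 - 1)) / (u1 - 1)) + B * (- ((u1 - 1) * (u2 - 1)) / (u2 - 1))
      = - (A * (u2 - 1) + B * (u1 - 1)) by field; rewrite d1 d2.
  have -> : A * (u2 - 1) + B * (u1 - 1) = (A + B) * (u1 + u2) - (A * u1 + B * u2) - (A + B) by ring.
  by rewrite AB ABu /u1 /u2; field.
clearbody A B u1 u2; clear q2 w0 q0 qn prod; clearbody q w.
pose M m := A * ((u1 ^+ m.+1 - 1) / (u1 - 1)) + B * ((u2 ^+ m.+1 - 1) / (u2 - 1)).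
have M0 : M 0%N = 1 by rewrite /M !expr1 !divff // !mulr1 AB.
have M1 : M 1%N = 1 + s.
  rewrite /M; have -> : (u1 ^+ 2 - 1) / (u1 - 1) = u1 + 1 by field.
  have -> : (u2 ^+ 2 - 1) / (u2 - 1) = u2 + 1 by field.
  by rewrite !mulrDr !mulr1 addrACA AB ABu addrC.
have MSS m : M m.+2 = (s - 1) * M m.+1 + z%:R * M m + 2.
  by rewrite /M (geometric_rec m n1 Eu1) (geometric_rec m n2 Eu2) -[X in _ = _ + X]c; ring.
have t1 : tau r z 1 = (r + z).+1 by rewrite tauS /tau /sigma /= !muln1.
suff H m : M m = (tau r z m)%:R /\ M m.+1 = (tau r z m.+1)%:R by case: (H k).
elim: m => [|m [IH1 IH2]].
  by rewrite M0 M1 t1 -natr1 natrD /s; split=> //; ring.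
split=> //; rewrite MSS IH1 IH2 tauSS // !natrD !natrM.
have -> : r.-1%:R = r%:R - 1 :> R by rewrite -[in r%:R](prednK r0) -natr1 addrK.
by rewrite /s; ring.
Qed.

Lemma order_defect_one (R : rcfType) (r z k n : nat) : (0 < r)%N -> (0 < z)%N ->
  n%:R = moore_bound R r z k - 1%:R <-> n.+1 = tau r z k.
Proof.
move=> r0 z0; rewrite moore_bound_tau //; split=> [H|<-].
  by apply/eqP; rewrite -(eqr_nat R) -natr1 H subrK.
by rewrite -natr1 addrK.
Qed.

End MooreBoundTau.

(** * Distances and the diameter *)

Lemma ohead_filter_iota (P : pred nat) a n m : P m -> a <= m < a + n ->
  exists2 m', ohead [seq i <- iota a n | P i] = Some m' & m' <= m.
Proof.
elim: n a => [|n IH] a Pm; first by lia.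
move=> H; rewrite /=; case Pa: (P a); first by exists a => //; lia.
apply: IH => //; have : a != m by apply: contraFneq Pa => ->.
lia.
Qed.

Section PathDistance.

Variable G : mixedGraph.

Lemma dist_path (u v : G) p : path (@step G) u p -> last u p = v -> uniq (u :: p) ->
  exists2 m, dist u v = Some m & m <= size p.
Proof.
move=> Pp lp U; apply: ohead_filter_iota.
  by apply/existsP; exists (in_tuple p); rewrite /= Pp lp eqxx.
by have := card_uniqP U => /= <-; rewrite add0n; apply: max_card.
Qed.

Lemma dist_has_path (u v : G) m : dist u v = Some m -> has_path u v m.
Proof.
rewrite /dist => E; have : m \in [seq m <- iota 0 #|G| | has_path u v m].
  by case: [seq _ <- _ | _] E => //= a s [->]; rewrite inE eqxx.
by rewrite mem_filter => /andP[].
Qed.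

Lemma has_pathP (u v : G) m : has_path u v m ->
  exists p, [/\ path (@step G) u p, last u p = v, uniq (u :: p) & size p = m].
Proof. by case/existsP => p /and3P[H1 /eqP H2 H3]; exists p; rewrite size_tuple. Qed.

Lemma has_diameter_unique k k' : has_diameter G k -> has_diameter G k' -> k = k'.
Proof.
move=> [H1 [u [v E]]] [H1' [u' [v' E']]].
have [m Em lm] := H1' u v; have [m' Em' lm'] := H1 u' v'.
move: Em Em'; rewrite E E' => -[Em] [Em']; lia.
Qed.

End PathDistance.

(** * The graphs H1, H2 and H3 *)

Section ListGraphs.

Variables (es ars : seq (nat * nat)) (wf : well_formed es ars) (h : table_graph).
Hypothesis rep : represents h es ars.

Let G := list_graph wf.

Lemma op_table_lt b (x : 'I_10) : nth 0 (op_table h b) x < 10.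
Proof.
have := allP rep x; rewrite mem_iota /= ltn_ord => /(_ isT)/and3P[].
by case: b.
Qed.

Definition list_op (b : bool) (x : G) : G := Ordinal (op_table_lt b x).

Lemma list_op_edge (x y : G) : edge x y = (y == list_op false x).
Proof.
have := allP rep (val x); rewrite mem_iota ltn_ord => /(_ isT)/and3P[_ _].
by move=> /allP/(_ (val y)); rewrite mem_iota ltn_ord => /(_ isT)/andP[/eqP H _].
Qed.

Lemma list_op_arc (x y : G) : arc x y = (y == list_op true x).
Proof.
have := allP rep (val x); rewrite mem_iota ltn_ord => /(_ isT)/and3P[_ _].
by move=> /allP/(_ (val y)); rewrite mem_iota ltn_ord => /(_ isT)/andP[_ /eqP H].
Qed.

Fixpoint word_path (x : G) (w : seq bool) : seq G :=
  if w is b :: w' then list_op b x :: word_path (list_op b x) w' else [::].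

Fixpoint table_path (x : nat) (w : seq bool) : seq nat :=
  if w is b :: w' then nth 0 (op_table h b) x :: table_path (nth 0 (op_table h b) x) w'
  else [::].

Lemma word_path_val x w : map val (word_path x w) = table_path (val x) w.
Proof. by elim: w x => //= b w IH x; rewrite IH. Qed.

Lemma word_pathP x w : path (@step G) x (word_path x w).
Proof.
elim: w x => //= b w IH x; rewrite IH andbT /step list_op_edge list_op_arc.
by case: b; rewrite eqxx ?orbT.
Qed.

Lemma size_word_path x w : size (word_path x w) = size w.
Proof. by elim: w x => //= b w IH x; rewrite IH. Qed.

Lemma act_val x w : val (act list_op w x) = last (val x) (table_path (val x) w).
Proof. by elim: w x => //= b w IH x; rewrite -IH. Qed.

Lemma val_iter_op n (x : G) :
  val (iter n (list_op true) x) = iter n (nth 0 h.2) (val x).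
Proof. by elim: n => //= n ->. Qed.

(** The second part lists all seven words of length at most 2, [[:: false; false]] included, since
    the words provided by [path_act] may be arbitrary. *)
Definition diameter3_check : bool :=
  all (fun x => all (fun y => has (fun w =>
      uniq (x :: table_path x w) && (last x (table_path x w) == y)) short_words)
    (iota 0 10)) (iota 0 10) &&
  has (fun x => has (fun y => all (fun w => last x (table_path x w) != y)
      [:: [::]; [:: false]; [:: true]; [:: false; false]; [:: false; true];
          [:: true; false]; [:: true; true]]) (iota 0 10)) (iota 0 10).

Lemma list_graph_rzk (R : rcfType) : diameter3_check -> is_rzk_graph R 1 1 3 1 G.
Proof.
move=> /andP[/allP H /hasP[x x10 /hasP[y y10 /allP N]]].
have card_G : #|G| = 10 by rewrite card_ord.
have short (u v : G) : exists2 m, dist u v = Some m & m <= 3.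
  have := H (val u); rewrite mem_iota ltn_ord => /(_ isT)/allP/(_ (val v)).
  rewrite mem_iota ltn_ord => /(_ isT)/hasP[w sw /andP[U /eqP E]].
  have [m Em lm] : exists2 m, dist u v = Some m & m <= size (word_path u w).
    apply: dist_path; first exact: word_pathP.
      by apply: val_inj; rewrite -E -word_path_val last_map.
    by rewrite -(map_inj_uniq val_inj) /= word_path_val.
  exists m => //; apply: leq_trans lm _; rewrite size_word_path.
  by have /allP := (isT : all (fun w => size w <= 3) short_words); apply.
have deg1 (v : G) : undirected_degree v = 1.
  rewrite /undirected_degree (_ : [set _ | _] = [set list_op false v]) ?cards1 //.
  by apply/setP => u; rewrite !inE list_op_edge.
have out1 (v : G) : out_degree v = 1.
  rewrite /out_degree (_ : [set _ | _] = [set list_op true v]) ?cards1 //.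
  by apply/setP => u; rewrite !inE list_op_arc.
have max1 (F : G -> nat) : (forall v, F v = 1) -> \max_v F v = 1.
  move=> F1; rewrite (eq_bigr (fun=> 1)) // big_const card_G.
  by [].
split.
- split=> //; rewrite mem_iota in x10; rewrite mem_iota in y10.
  exists (Ordinal x10), (Ordinal y10); have [m Em lm] := short (Ordinal x10) (Ordinal y10).
  have [p [Pp lp _ sp]] := has_pathP (dist_has_path Em).
  have [w sw aw] := path_act list_op_edge list_op_arc Pp.
  have : val (act list_op w (Ordinal x10)) = y by rewrite -aw lp.
  rewrite act_val /= => Ew; rewrite Em; congr Some.
  have [m2|m4|//] := ltngtP m 3; last by rewrite leqNgt m4 in lm.
  have /N : w \in [:: [::]; [:: false]; [:: true]; [:: false; false]; [:: false; true];
          [:: true; false]; [:: true; true]].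
    by case: w sw {aw Ew} => [|[] [|[] [|b w]]] //= sw; move: m2; rewrite -sp -sw.
  by rewrite Ew eqxx.
- exact: max1.
- exact: max1.
by apply/order_defect_one; rewrite ?card_G.
Qed.

End ListGraphs.

(** The invariant that separates the three graphs. Their arcs form cycles of lengths 5 and 5, 10,
    and 6 and 4, so n = 5 singles out H1, and n = 10 separates H2 from H3, as 10 is a multiple of
    neither 6 nor 4. *)
Definition closed_arc_walk (G : mixedGraph) (n : nat) : Prop :=
  exists x : G, exists p, [/\ path (@arc G) x p, size p = n & last x p = x].

Lemma closed_arc_walk_iso (G H : mixedGraph) n :
  isomorphic G H -> closed_arc_walk G n -> closed_arc_walk H n.
Proof.
move=> [g [_ _ ga]] [x [p [Pp sp lp]]]; exists (g x), (map g p).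
rewrite size_map last_map lp; split=> //.
by elim: p x Pp {sp lp} => //= y p IH x /andP[xy /IH ->]; rewrite ga xy.
Qed.

Lemma closed_arc_walkP es ars (wf : well_formed es ars) h n : represents h es ars ->
  closed_arc_walk (list_graph wf) n <->
  has (fun x => iter n (nth 0 h.2) x == x) (iota 0 10).
Proof.
move=> rep; set G := list_graph wf.
have E (x : G) : iter n (list_op rep true) x = x <-> iter n (nth 0 h.2) (val x) = val x.
  by rewrite -(val_iter_op rep); split=> [->//|]; apply: val_inj.
split.
  move=> [x [p [Pp sp lp]]]; apply/hasP; exists (val x); first by rewrite mem_iota ltn_ord.
  by rewrite -{1}sp; apply/eqP; rewrite sp; apply/E; rewrite -{1}sp -(path_arc_act (list_op_arc rep) Pp).
move=> /hasP[x]; rewrite mem_iota => x10 /eqP Ex.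
exists (Ordinal x10 : G), (traject (list_op rep true) (list_op rep true (Ordinal x10)) n).
rewrite size_traject last_traject; split=> //; last by apply/E.
apply: sub_path (fpath_traject _ _ _) => a b /eqP <-.
by rewrite (list_op_arc rep) eqxx.
Qed.

Lemma represents1 : represents T1 H1_edges H1_arcs. Proof. by vm_compute. Qed.
Lemma represents2 : represents T2 H2_edges H2_arcs. Proof. by vm_compute. Qed.
Lemma represents3 : represents T3 H3_edges H3_arcs. Proof. by vm_compute. Qed.

Lemma not_isomorphic es ars es' ars' (wf : well_formed es ars) (wf' : well_formed es' ars')
    h h' n : represents h es ars -> represents h' es' ars' ->
  has (fun x => iter n (nth 0 h.2) x == x) (iota 0 10) ->
  ~~ has (fun x => iter n (nth 0 h'.2) x == x) (iota 0 10) ->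
  ~ isomorphic (list_graph wf) (list_graph wf').
Proof.
move=> rep rep' C /negP C' I; apply: C'; apply/(closed_arc_walkP wf' n rep').
by apply: closed_arc_walk_iso I _; apply/(closed_arc_walkP wf n rep).
Qed.

Lemma almost_moore_classification (R : rcfType) (G : mixedGraph) (k : nat) :
  almost_mixed_moore R G -> has_diameter G k -> 3 <= k ->
  [\/ isomorphic G H1, isomorphic G H2 | isomorphic G H3].
Proof.
move=> [r [z [k' [r0 z0 [D Dr Dz cardG]]]]] D' k3.
have kk : k' = k := has_diameter_unique D D'.
subst k'.
have order_G : #|G|.+1 = tau r z k.
  exact/(order_defect_one R k _ r0 z0).
have max_r (v : G) : undirected_degree v <= r.
  by rewrite -Dr; apply: (@leq_bigmax_cond _ predT (@undirected_degree G)).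
have max_z (v : G) : out_degree v <= z.
  by rewrite -Dz; apply: (@leq_bigmax_cond _ predT (@out_degree G)).
have reach (u x : G) : exists2 p, walk k u p & last u p = x.
  have [m Em mk] := D.1 u x; have [p [Pp lp Up sp]] := has_pathP (dist_has_path Em).
  by exists p => //; rewrite /walk path_nbw //= sp.
have full (u : G) : undirected_degree u = r /\ out_degree u = z.
  suff : ~~ ((undirected_degree u < r) || (out_degree u < z)).
    have := max_r u; have := max_z u; lia.
  (* A vertex of smaller degree starts at most [tau r z k - 2] walks, too few to reach all
     vertices. *)
  apply/negP => /(size_tree_deficient max_r max_z r0 z0 (k - 2)).
  have -> : (k - 2).+2 = k by lia.
  have : #|G| <= size (tree k u u).
    rewrite -(size_map (last u)) cardE; apply: uniq_leq_size; first exact: enum_uniq.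
    move=> x _; have [p /andP[np sp] <-] := reach u x; apply: map_f.
    by rewrite mem_tree sp.
  move: order_G; lia.
have deg u := (full u).1; have out u := (full u).2.
have G0 : 0 < #|G| by case: D => _ [u _]; apply/card_gt0P; exists u.
have z1 : z = 1 := arc_degree_eq1 r0 z0 k3 deg out reach order_G R G0.
have r1 : r = 1 := edge_degree_eq1_z1 r0 z0 k3 deg out reach order_G z1.
have k_eq : k = 3 := diameter_eq3_z1 r0 z0 k3 deg out reach order_G z1 r1.
have [x0 _] := card_gt0P G0.
have [m Hm] : exists m : G -> G, forall x y, edge x y = (y == m x).
  have /fin_all_exists[m Hm] : forall x : G, exists y, [set t | edge x t] = [set y].
    by move=> x; apply/cards1P; rewrite -/(undirected_degree x) deg r1.
  by exists m => x y; rewrite -in_set1 -Hm inE.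
have [o Ho] : exists o : G -> G, forall x y, arc x y = (y == o x).
  have /fin_all_exists[o Ho] : forall x : G, exists y, [set t | arc x t] = [set y].
    by move=> x; apply/cards1P; rewrite -/(out_degree x) out z1.
  by exists o => x y; rewrite -in_set1 -Ho inE.
pose f (b : bool) := if b then o else m.
apply: (@classification G f) => //.
  by move: order_G; rewrite r1 z1 k_eq => -[].
move=> u x; have [p /andP[np sp] <-] := reach u x.
move: sp; rewrite k_eq => sp; apply/mapP.
have mm x : m (m x) = x := @f_false_inv G f Hm x.
have fs a b : step a b -> exists c, b = f c a by apply: (@step_f G f).
case: p np sp => [|a [|b [|c [|d p]]]] //.
- by exists [::].
- move=> /and3P[/fs[i ->] _ _] _; exists [:: i] => //; by case: i.
- move=> /and3P[/fs[i ->] _ /and3P[/fs[j ->] ne _]] _; exists [:: i; j] => //.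
  by case: i j ne => [] [] //; rewrite /f mm eqxx.
- move=> /and3P[/fs[i ->] _ /and3P[/fs[j ->] ne /and3P[/fs[l ->] ne' _]]] _.
  exists [:: i; j; l] => //.
  by case: i j l ne ne' => [] [] [] //; rewrite /f mm eqxx.
Qed.

Theorem mainTheorem2 (R : rcfType) :
  [/\ forall (G : mixedGraph) (k : nat),
        almost_mixed_moore R G -> has_diameter G k -> (3 <= k)%N ->
        [\/ isomorphic G H1, isomorphic G H2 | isomorphic G H3],
      [/\ is_rzk_graph R 1 1 3 1 H1,
          is_rzk_graph R 1 1 3 1 H2
        & is_rzk_graph R 1 1 3 1 H3]
    & [/\ ~ isomorphic H1 H2, ~ isomorphic H1 H3 & ~ isomorphic H2 H3]].
Proof.
split; first exact: almost_moore_classification.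
  split.
  - by apply: (list_graph_rzk _ represents1); vm_compute.
  - by apply: (list_graph_rzk _ represents2); vm_compute.
  - by apply: (list_graph_rzk _ represents3); vm_compute.
split.
- by apply: (@not_isomorphic _ _ _ _ _ _ _ _ 5 represents1 represents2); vm_compute.
- by apply: (@not_isomorphic _ _ _ _ _ _ _ _ 5 represents1 represents3); vm_compute.
- by apply: (@not_isomorphic _ _ _ _ _ _ _ _ 10 represents2 represents3); vm_compute.
Qed.
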